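(* For any functors $f\colon B\to A$ and $g\colon C\to A$ of quasi-categories, the comma quasi-category $f\downarrow g$, with its canonical cone $(p_1,p_0,\psi)$, is a weak comma object in the 2-category $\mathrm{qCat}_2$. That is, for every quasi-category $X$, the functor $$\hom'(X,f\downarrow g)\longrightarrow\hom'(X,f)\downarrow\hom'(X,g)$$ to the ordinary comma category, induced by composition with the cone $\psi\colon fp_0\Rightarrow gp_1$, is a smothering functor.
   Context: A quasi-category is a simplicial set with fillers for all inner horns; functors are simplicial maps between quasi-categories. $\mathrm{qCat}_2$ is the strict 2-category of quasi-categories with hom-categories $\hom'(A,B)=h(B^A)$, where $B^A$ is the internal hom of simplicial sets and $h\colon\mathrm{sSet}\to\mathrm{Cat}$ is left adjoint to the nerve. The comma quasi-category $f\downarrow g$ is the pullback of simplicial sets of the map $(\mathrm{cod},\mathrm{dom})\colon A^{\Delta^1}\to A\times A$ along $g\times f\colon C\times B\to A\times A$; it is a quasi-category. Its projections are $p_1\colon f\downarrow g\to C$ and $p_0\colon f\downarrow g\to B$, and the projection $f\downarrow g\to A^{\Delta^1}$ transposes to a map $(f\downarrow g)\times\Delta^1\to A$ representing a canonical 2-cell $\psi\colon fp_0\Rightarrow gp_1$. The objects of the ordinary comma category $\hom'(X,f)\downarrow\hom'(X,g)$ are triples $(b\colon X\to B,\ c\colon X\to C,\ \alpha\colon fb\Rightarrow gc)$. The displayed functor sends $a\colon X\to f\downarrow g$ to $(p_0a,p_1a,\psi a)$ and a 2-cell $\tau$ to $(p_0\tau,p_1\tau)$. A functor between categories is smothering if it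 is surjective on objects, full, and conservative (reflects isomorphisms). *)

(* Defs.v *)
From mathcomp Require Import all_boot boolp.

Set Implicit Arguments.
Unset Strict Implicit.
Unset Printing Implicit Defensive.
#[local] Obligation Tactic := idtac.

Local Open Scope quotient_scope.

Declare Scope qcat_scope.
Delimit Scope qcat_scope with qcat.
Local Open Scope qcat_scope.

Reserved Notation "v \oc u" (at level 40, left associativity).

Record category := Category {
  cobj :> Type;
  chom : cobj -> cobj -> Type;
  cid : forall x, chom x x;
  ccomp : forall x y z, chom y z -> chom x y -> chom x z;
  ccompA : forall x y z t (w : chom z t) (v : chom y z) (u : chom x y),
    ccomp w (ccomp v u) = ccomp (ccomp w v) u;
  ccomp1l : forall x y (u : chom x y), ccomp (cid y) u = u;
  ccomp1r : forall x y (u : chom x y), ccomp u (cid x) = u }.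

Arguments chom {c} x y.
Arguments cid {c} x.
Arguments ccomp {c x y z} v u.

Notation "v \oc u" := (ccomp v u) : qcat_scope.

Record functor (C D : category) := Functor {
  fobj :> C -> D;
  fhom : forall x y, chom x y -> chom (fobj x) (fobj y);
  fhom1 : forall x, fhom (cid x) = cid (fobj x);
  fhomM : forall x y z (v : chom y z) (u : chom x y),
    fhom (v \oc u) = fhom v \oc fhom u }.

Arguments fhom {C D} F {x y} u : rename.

Definition is_iso (C : category) (x y : C) (u : chom x y) : Prop :=
  exists v : chom y x, v \oc u = cid x /\ u \oc v = cid y.

Definition surjective_on_objects (C D : category) (F : functor C D) : Prop :=
  forall y : D, exists x : C, F x = y.

Definition full (C D : category) (F : functor C D) : Prop :=
  forall (x y : C) (v : chom (F x) (F y)), exists u : chom x y, fhom F u = v.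

Definition conservative (C D : category) (F : functor C D) : Prop :=
  forall (x y : C) (u : chom x y), is_iso (fhom F u) -> is_iso u.

Definition smothering (C D : category) (F : functor C D) : Prop :=
  [/\ surjective_on_objects F, full F & conservative F].

(** Transport of a morphism along equalities of its endpoints. *)
Definition hcast (C : category) (x y x' y' : C) (ex : x = x') (ey : y = y')
    (u : chom x y) : chom x' y' :=
  ecast y (chom x' y) ey (ecast x (chom x y) ex u).

Lemma hcast_id (C : category) (x y : C) (ex : x = x) (ey : y = y)
  (u : chom x y) : hcast ex ey u = u.
Proof.
by rewrite (Prop_irrelevance ex erefl) (Prop_irrelevance ey erefl).
Qed.

Lemma hcast_irr (C : category) (x y x' y' : C) (ex ex' : x = x')
  (ey ey' : y = y') (u : chom x y) : hcast ex ey u = hcast ex' ey' u.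
Proof. by subst; rewrite !hcast_id. Qed.

Lemma hcast_cid (C : category) (x x' : C) (ex ey : x = x') :
  hcast ex ey (cid x) = cid x'.
Proof. by subst; rewrite hcast_id. Qed.

Lemma hcast_comp (C : category) (x y z x' y' z' : C) (ex : x = x')
  (ey : y = y') (ez : z = z') (v : chom y z) (u : chom x y) :
  hcast ex ez (v \oc u) = hcast ey ez v \oc hcast ex ey u.
Proof. by subst; rewrite !hcast_id. Qed.

Lemma hcast_trans (C : category) (x y x' y' x'' y'' : C) (ex : x = x')
  (ey : y = y') (ex' : x' = x'') (ey' : y' = y'') (u : chom x y) :
  hcast ex' ey' (hcast ex ey u) = hcast (etrans ex ex') (etrans ey ey') u.
Proof. by subst; rewrite !hcast_id. Qed.

Section CommaCategory.
Variables (D E K : category) (F : functor D K) (G : functor E K).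

Record comma_obj := CommaObj {
  co_dom : D;
  co_cod : E;
  co_arr : chom (F co_dom) (G co_cod) }.

Record comma_hom (x y : comma_obj) := CommaHom {
  ch_dom : chom (co_dom x) (co_dom y);
  ch_cod : chom (co_cod x) (co_cod y);
  ch_comm : fhom G ch_cod \oc co_arr x = co_arr y \oc fhom F ch_dom }.

Lemma comma_hom_eq (x y : comma_obj) (u v : comma_hom x y) :
  ch_dom u = ch_dom v -> ch_cod u = ch_cod v -> u = v.
Proof.
case: u v => [u1 u2 u3] [v1 v2 v3] /= e1 e2; subst.
by congr CommaHom; exact: Prop_irrelevance.
Qed.

Program Definition comma_cid (x : comma_obj) : comma_hom x x :=
  @CommaHom x x (cid _) (cid _) _.
Next Obligation. by move=> x; rewrite !fhom1 ccomp1l ccomp1r. Qed.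

Program Definition comma_comp (x y z : comma_obj) (v : comma_hom y z)
    (u : comma_hom x y) : comma_hom x z :=
  @CommaHom x z (ch_dom v \oc ch_dom u) (ch_cod v \oc ch_cod u) _.
Next Obligation.
move=> x y z v u.
by rewrite !fhomM -ccompA ch_comm ccompA ch_comm -ccompA.
Qed.

Program Definition comma_category : category :=
  @Category comma_obj comma_hom comma_cid comma_comp _ _ _.
Next Obligation. by move=> *; apply: comma_hom_eq => /=; rewrite ccompA. Qed.
Next Obligation. by move=> *; apply: comma_hom_eq => /=; rewrite ccomp1l. Qed.
Next Obligation. by move=> *; apply: comma_hom_eq => /=; rewrite ccomp1r. Qed.

End CommaCategory.

(** [dmap m n] is the set of maps [m] -> [n] in the simplex category. *)

Record dmap (m n : nat) := DMap {
  dfun :> 'I_m.+1 -> 'I_n.+1;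
  dmono : forall i j : 'I_m.+1, i <= j -> dfun i <= dfun j }.

Lemma dmap_eq m n (s t : dmap m n) : dfun s =1 dfun t -> s = t.
Proof.
case: s t => [s ps] [t pt] /= /funext e; subst.
by congr DMap; exact: Prop_irrelevance.
Qed.

Definition did n : dmap n n := @DMap n n id (fun _ _ h => h).

Definition dcomp m n p (t : dmap n p) (s : dmap m n) : dmap m p :=
  @DMap m p (fun i => t (s i)) (fun i j h => dmono t (dmono s h)).

Definition dconst m n (i : 'I_n.+1) : dmap m n :=
  @DMap m n (fun=> i) (fun _ _ _ => leqnn i).

Program Definition dface n (k : 'I_n.+2) : dmap n n.+1 :=
  @DMap n n.+1 (lift k) _.
Next Obligation. by move=> n k i j h; rewrite /= leq_bump2. Qed.

Record sset := SSet {
  cell :> nat -> Type;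
  act : forall m n, dmap m n -> cell n -> cell m;
  act1 : forall n (x : cell n), act (did n) x = x;
  actM : forall m n p (t : dmap n p) (s : dmap m n) (x : cell p),
    act (dcomp t s) x = act s (act t x) }.

Arguments act {s m n} t x : rename.

Record smap (X Y : sset) := SMap {
  sfun :> forall n, X n -> Y n;
  snat : forall m n (t : dmap m n) (x : X n), sfun (act t x) = act t (sfun x) }.

Arguments sfun {X Y} f {n} x : rename.
Arguments snat {X Y} f {m n} t x : rename.

Lemma smap_eq (X Y : sset) (f g : smap X Y) :
  (forall n (x : X n), f n x = g n x) -> f = g.
Proof.
case: f g => [f pf] [g pg] /= h.
have e : f = g by apply: functional_extensionality_dep => n; apply/funext/h.
by subst; congr SMap; exact: Prop_irrelevance.
Qed.

Program Definition sid (X : sset) : smap X X := @SMap X X (fun _ x => x) _.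
Next Obligation. by []. Qed.

Program Definition scomp (X Y Z : sset) (g : smap Y Z) (f : smap X Y) :
  smap X Z := @SMap X Z (fun n x => g n (f n x)) _.
Next Obligation. by move=> *; rewrite /= !snat. Qed.

Program Definition simplex (n : nat) : sset :=
  @SSet (fun m => dmap m n) (fun l m s t => dcomp t s) _ _.
Next Obligation. by move=> *; exact: dmap_eq. Qed.
Next Obligation. by move=> *; exact: dmap_eq. Qed.

Program Definition simplex_map m n (t : dmap m n) :
  smap (simplex m) (simplex n) := @SMap _ _ (fun _ s => dcomp t s) _.
Next Obligation. by move=> *; exact: dmap_eq. Qed.

(** The horn: the simplices of [simplex n] that miss some vertex besides [k]. *)
Definition horn_pred n (k : 'I_n.+1) m (s : dmap m n) : Prop :=
  exists2 j : 'I_n.+1, j != k & forall i, s i != j.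

Program Definition horn (n : nat) (k : 'I_n.+1) : sset :=
  @SSet (fun m => {s : dmap m n | horn_pred k s})
        (fun l m t s => exist _ (dcomp (sval s) t) _) _ _.
Next Obligation. by move=> n k l m t [s [j jk sj]]; exists j => // i; exact: sj. Qed.
Next Obligation.
by move=> n k m [s ps]; apply: eq_exist; exact: dmap_eq.
Qed.
Next Obligation.
by move=> n k m p q t u [s ps]; apply: eq_exist; exact: dmap_eq.
Qed.

Program Definition horn_incl n (k : 'I_n.+1) : smap (horn k) (simplex n) :=
  @SMap _ _ (fun _ s => sval s) _.
Next Obligation. by []. Qed.

Definition quasi_category (X : sset) : Prop :=
  forall (n : nat) (k : 'I_n.+1), 0 < k < n ->
  forall h : smap (horn k) X,
  exists s : smap (simplex n) X, scomp s (horn_incl k) = h.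

Program Definition sprod (X Y : sset) : sset :=
  @SSet (fun n => (X n * Y n)%type)
        (fun m n t p => (act t p.1, act t p.2)) _ _.
Next Obligation. by move=> X Y n [x y] /=; rewrite !act1. Qed.
Next Obligation. by move=> X Y m n p t s [x y] /=; rewrite !actM. Qed.

Program Definition sfst X Y : smap (sprod X Y) X := @SMap _ _ (fun _ p => p.1) _.
Next Obligation. by []. Qed.

Program Definition ssnd X Y : smap (sprod X Y) Y := @SMap _ _ (fun _ p => p.2) _.
Next Obligation. by []. Qed.

Program Definition spair X Y Z (f : smap X Y) (g : smap X Z) :
  smap X (sprod Y Z) := @SMap _ _ (fun n x => (f n x, g n x)) _.
Next Obligation. by move=> *; rewrite /= !snat. Qed.

Definition sprod_map X X' Y Y' (f : smap X X') (g : smap Y Y') :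
    smap (sprod X Y) (sprod X' Y') :=
  spair (scomp f (sfst X Y)) (scomp g (ssnd X Y)).

Section Pullback.
Variables (X Y Z : sset) (u : smap X Z) (v : smap Y Z).

Program Definition pullback : sset :=
  @SSet (fun n => {p : X n * Y n | u n p.1 = v n p.2})
        (fun m n t p => exist _ (act t (sval p).1, act t (sval p).2) _) _ _.
Next Obligation. by move=> m n t [p e]; rewrite /= !snat e. Qed.
Next Obligation.
by move=> n [[x y] e]; apply: eq_exist; rewrite /= !act1.
Qed.
Next Obligation.
by move=> m n p t s [[x y] e]; apply: eq_exist; rewrite /= !actM.
Qed.

Program Definition pullback_fst : smap pullback X :=
  @SMap _ _ (fun _ p => (sval p).1) _.
Next Obligation. by []. Qed.

Program Definition pullback_snd : smap pullback Y :=
  @SMap _ _ (fun _ p => (sval p).2) _.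
Next Obligation. by []. Qed.

End Pullback.

(** [sexp X Y] is the internal hom Y^X. *)
Program Definition sexp (X Y : sset) : sset :=
  @SSet (fun n => smap (sprod X (simplex n)) Y)
        (fun m n t a => scomp a (sprod_map (sid X) (simplex_map t))) _ _.
Next Obligation.
by move=> X Y n a; apply: smap_eq => m [x s] /=; congr (a _ (_, _)); exact: dmap_eq.
Qed.
Next Obligation.
by move=> X Y m n p t s a; apply: smap_eq => k [x r] /=; congr (a _ (_, _));
  exact: dmap_eq.
Qed.

Program Definition sexp_post (X : sset) (Y Y' : sset) (f : smap Y Y') :
  smap (sexp X Y) (sexp X Y') := @SMap _ _ (fun n a => scomp f a) _.
Next Obligation. by move=> *; exact: smap_eq. Qed.

Program Definition sexp_pre (X X' : sset) (f : smap X X') (Y : sset) :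
    smap (sexp X' Y) (sexp X Y) :=
  @SMap _ _ (fun n a => scomp a (sprod_map f (sid (simplex n)))) _.
Next Obligation. by move=> *; exact: smap_eq. Qed.

(** [vertex_of] and [map_of] are the bijection between maps X -> Y and vertices of Y^X. *)
Definition vertex_of (X Y : sset) (f : smap X Y) : sexp X Y 0 :=
  scomp f (sfst X (simplex 0)).

Program Definition map_of (X Y : sset) (a : sexp X Y 0) : smap X Y :=
  @SMap X Y (fun n x => sfun (a : smap _ _) (x, dconst n ord0)) _.
Next Obligation.
by move=> X Y a m n t x; rewrite -snat; congr sfun; congr pair; exact: dmap_eq.
Qed.

Lemma dmap0 m (s t : dmap m 0) : s = t.
Proof. by apply: dmap_eq => i; rewrite !ord1. Qed.

Lemma vertex_ofK X Y : cancel (@vertex_of X Y) (@map_of X Y).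
Proof. by move=> f; exact: smap_eq. Qed.

Lemma map_ofK X Y : cancel (@map_of X Y) (@vertex_of X Y).
Proof.
move=> a; apply: smap_eq => n [x s] /=; congr sfun; congr pair; exact: dmap0.
Qed.

(** Y^(simplex 1) -> Y, evaluation at the vertex [i]: this is the domain map
    for [i = 0] and the codomain map for [i = 1]. *)
Program Definition sexp_ev (i : 'I_2) (Y : sset) :
    smap (sexp (simplex 1) Y) Y :=
  @SMap _ _ (fun n a => sfun (a : smap _ _) (dconst n i, did n)) _.
Next Obligation.
move=> i Y m n t a; rewrite -snat /=.
by congr sfun; congr pair; exact: dmap_eq.
Qed.

(** The transpose X x K -> Y of a map X -> Y^K. *)
Program Definition transpose (X K Y : sset) (q : smap X (sexp K Y)) :
    smap (sprod X K) Y :=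
  @SMap _ _ (fun n p => sfun (q n p.1 : smap _ _) (p.2, did n)) _.
Next Obligation.
move=> X K Y q m n t [x k] /=; rewrite snat /= -snat /=.
by congr sfun; congr pair; exact: dmap_eq.
Qed.

(** [dface k : dmap n n.+1] omits [k]: face 1 of an edge is its source. *)
Record edge (X : sset) (x y : X 0) := Edge {
  edge_cell :> X 1;
  edge_src : act (@dface 0 ord_max) edge_cell = x;
  edge_tgt : act (@dface 0 ord0) edge_cell = y }.

Definition degen (X : sset) (x : X 0) : X 1 := act (dconst 1 ord0) x.

Inductive epath (X : sset) : X 0 -> X 0 -> Type :=
| pnil x : epath x x
| pcons x y z (e : edge x y) (p : epath y z) : epath x z.

Arguments pnil {X} x.
Arguments pcons {X x y z} e p.

(** The congruence on the free category on the graph of [X] generated by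
    [s0 x = id x] and [d1 s = d0 s \oc d2 s]. *)
Inductive path_rel (X : sset) : forall x y : X 0, epath x y -> epath x y -> Prop :=
| path_rel_refl x y (p : epath x y) : path_rel p p
| path_rel_sym x y (p q : epath x y) : path_rel p q -> path_rel q p
| path_rel_trans x y (p q r : epath x y) :
    path_rel p q -> path_rel q r -> path_rel p r
| path_rel_cons x y z (e : edge x y) (p q : epath y z) :
    path_rel p q -> path_rel (pcons e p) (pcons e q)
| path_rel_degen x y (e : edge x x) (p : epath x y) :
    edge_cell e = degen x -> path_rel (pcons e p) p
| path_rel_triangle x y z t (s : X 2) (e01 : edge x y) (e12 : edge y z)
    (e02 : edge x z) (p : epath z t) :
    act (@dface 1 ord_max) s = edge_cell e01 ->
    act (@dface 1 ord0) s = edge_cell e12 ->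
    act (@dface 1 (@Ordinal 3 1 isT)) s = edge_cell e02 ->
    path_rel (pcons e01 (pcons e12 p)) (pcons e02 p).

Arguments path_rel {X x y} p q.

Section HomotopyCategory.
Variable X : sset.
Implicit Types x y z t : X 0.

Fixpoint pcat x y z (p : epath x y) : epath y z -> epath x z :=
  match p with
  | pnil _ => id
  | pcons _ _ _ e p' => fun q => pcons e (pcat p' q)
  end.

Lemma pcatA x y z t (p : epath x y) (q : epath y z) (r : epath z t) :
  pcat p (pcat q r) = pcat (pcat p q) r.
Proof. by elim: p q => //= x' y' z' e p IH q; rewrite IH. Qed.

Lemma pcat1 x y (p : epath x y) : pcat p (pnil y) = p.
Proof. by elim: p => //= x' y' z' e p ->. Qed.

Lemma path_rel_catr x y z (p : epath x y) (q q' : epath y z) :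
  path_rel q q' -> path_rel (pcat p q) (pcat p q').
Proof. by elim: p q q' => //= *; apply: path_rel_cons; auto. Qed.

Lemma path_rel_catl x y z (p p' : epath x y) (q : epath y z) :
  path_rel p p' -> path_rel (pcat p q) (pcat p' q).
Proof.
move=> pp'; elim: pp' q => {x y p p'} /=.
- by move=> *; exact: path_rel_refl.
- by move=> *; apply: path_rel_sym; auto.
- by move=> x y p q r _ IH1 _ IH2 s; apply: path_rel_trans (IH1 s) (IH2 s).
- by move=> *; apply: path_rel_cons; auto.
- by move=> *; exact: path_rel_degen.
- by move=> *; apply: path_rel_triangle; eauto.
Qed.

Section Quotient.
Variables x y : X 0.

Definition path_relb : rel {classic epath x y} := fun p q => `[< path_rel p q >].

Lemma path_relb_refl : reflexive path_relb.
Proof. by move=> p; apply/asboolP; exact: path_rel_refl. Qed.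

Lemma path_relb_sym : symmetric path_relb.
Proof.
by move=> p q; apply/asboolP/asboolP => /path_rel_sym.
Qed.

Lemma path_relb_trans : transitive path_relb.
Proof.
by move=> q p r /asboolP pq /asboolP qr; apply/asboolP; apply: path_rel_trans qr.
Qed.

Canonical path_equiv :=
  EquivRel path_relb path_relb_refl path_relb_sym path_relb_trans.

Definition ho_hom : Type := {eq_quot path_equiv}.

Definition cls (p : epath x y) : ho_hom := \pi_{eq_quot path_equiv} p.

Definition ho_repr (c : ho_hom) : epath x y := repr (c : {eq_quot path_equiv}).

Lemma ho_reprK : cancel ho_repr cls.
Proof. by move=> c; rewrite /cls /ho_repr reprK. Qed.

Lemma clsP (p q : epath x y) : cls p = cls q <-> path_rel p q.
Proof.
split=> [/eqmodP/asboolP //|h].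
by apply/eqmodP/asboolP.
Qed.

Lemma path_rel_repr (p : epath x y) : path_rel (ho_repr (cls p)) p.
Proof. by apply/clsP; rewrite ho_reprK. Qed.

End Quotient.

Definition ho_comp x y z (d : ho_hom y z) (c : ho_hom x y) : ho_hom x z :=
  cls (pcat (ho_repr c) (ho_repr d)).

Lemma ho_compE x y z (q : epath y z) (p : epath x y) :
  ho_comp (cls q) (cls p) = cls (pcat p q).
Proof.
apply/clsP; apply: path_rel_trans (path_rel_catr _ (path_rel_repr q)).
exact: path_rel_catl (path_rel_repr p).
Qed.

Program Definition ho : category :=
  @Category (X 0) ho_hom (fun x => cls (pnil x)) ho_comp _ _ _.
Next Obligation.
move=> x y z t w v u; rewrite -(ho_reprK u) -(ho_reprK v) -(ho_reprK w).
by rewrite !ho_compE pcatA.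
Qed.
Next Obligation. by move=> x y u; rewrite -(ho_reprK u) ho_compE pcat1. Qed.
Next Obligation. by move=> x y u; rewrite -(ho_reprK u) ho_compE. Qed.

Definition ho_edge x y (e : edge x y) : @chom ho x y := cls (pcons e (pnil y)).

End HomotopyCategory.

Arguments cls {X x y} p.
Arguments ho_edge {X x y} e.

Section HoMap.
Variables (X Y : sset) (u : smap X Y).

Definition edge_map (x y : X 0) (e : edge x y) : edge (u 0 x) (u 0 y) :=
  @Edge Y (u 0 x) (u 0 y) (u 1 e)
    (etrans (esym (snat u _ _)) (congr1 (u 0) (edge_src e)))
    (etrans (esym (snat u _ _)) (congr1 (u 0) (edge_tgt e))).

Fixpoint path_map (x y : X 0) (p : epath x y) : epath (u 0 x) (u 0 y) :=
  match p with
  | pnil _ => pnil _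
  | pcons _ _ _ e p' => pcons (edge_map e) (path_map p')
  end.

Lemma path_map_cat (x y z : X 0) (p : epath x y) (q : epath y z) :
  path_map (pcat p q) = pcat (path_map p) (path_map q).
Proof. by elim: p q => //= *; congr pcons; auto. Qed.

Lemma path_map_rel (x y : X 0) (p q : epath x y) :
  path_rel p q -> path_rel (path_map p) (path_map q).
Proof.
elim=> {x y p q} /=.
- by move=> *; exact: path_rel_refl.
- by move=> *; exact: path_rel_sym.
- by move=> x y p q r _ h1 _ h2; exact: path_rel_trans h1 h2.
- by move=> *; exact: path_rel_cons.
- by move=> x y e p he; apply: path_rel_degen; rewrite /= he snat.
- move=> x y z t s e01 e12 e02 p h1 h2 h3.
  by apply: (@path_rel_triangle _ _ _ _ _ (u 2 s)); rewrite -snat ?h1 ?h2 ?h3.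
Qed.

Definition ho_map_hom (x y : ho X) (c : chom x y) :
  @chom (ho Y) (u 0 x) (u 0 y) := cls (path_map (ho_repr c)).

Lemma ho_map_homE (x y : X 0) (p : epath x y) :
  ho_map_hom (cls p) = cls (path_map p).
Proof. by apply/clsP; apply: path_map_rel; exact: path_rel_repr. Qed.

Program Definition ho_map : functor (ho X) (ho Y) :=
  @Functor (ho X) (ho Y) (u 0) ho_map_hom _ _.
Next Obligation. by move=> x; rewrite /= ho_map_homE. Qed.
Next Obligation.
move=> x y z v w; rewrite -(ho_reprK v) -(ho_reprK w) /= ho_compE !ho_map_homE.
by rewrite ho_compE path_map_cat.
Qed.

End HoMap.

Lemma functor_eq (C D : category) (F G : functor C D)
    (e : forall x, F x = G x) :
  (forall x y (u : chom x y), hcast (e x) (e y) (fhom F u) = fhom G u) -> F = G.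
Proof.
case: F G e => [F hF F1 FM] [G hG G1 GM] /= e.
have E : F = G by apply/funext.
subst G => h.
have E : hF = hG.
  apply: functional_extensionality_dep => x.
  apply: functional_extensionality_dep => y.
  by apply/funext => u; rewrite -h hcast_id.
by subst hG; congr Functor; exact: Prop_irrelevance.
Qed.

Lemma functor_eq_hom (C D : category) (F G : functor C D) (x y : C)
    (ex : F x = G x) (ey : F y = G y) (u : chom x y) :
  F = G -> hcast ex ey (fhom F u) = fhom G u.
Proof. by move=> E; subst G; rewrite hcast_id. Qed.

Program Definition fcomp (C D E : category) (G : functor D E)
    (F : functor C D) : functor C E :=
  @Functor C E (fun x => G (F x)) (fun _ _ u => fhom G (fhom F u)) _ _.
Next Obligation. by move=> *; rewrite /= !fhom1. Qed.
Next Obligation. by move=> *; rewrite /= !fhomM. Qed.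

(** The poset [n]; an n-simplex of the nerve is a functor out of it. *)
Program Definition ord_category (n : nat) : category :=
  @Category 'I_n.+1 (fun i j => i <= j) (fun i => leqnn i)
    (fun i j k jk ij => leq_trans ij jk) _ _ _.
Next Obligation. by intros; apply: (@Prop_irrelevance (_ <= _)). Qed.
Next Obligation. by intros; apply: (@Prop_irrelevance (_ <= _)). Qed.
Next Obligation. by intros; apply: (@Prop_irrelevance (_ <= _)). Qed.

Program Definition dmap_functor m n (t : dmap m n) :
    functor (ord_category m) (ord_category n) :=
  @Functor (ord_category m) (ord_category n) t (fun i j h => dmono t h) _ _.
Next Obligation. by intros; apply: (@Prop_irrelevance (_ <= _)). Qed.
Next Obligation. by intros; apply: (@Prop_irrelevance (_ <= _)). Qed.

Program Definition nerve (D : category) : sset :=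
  @SSet (fun n => functor (ord_category n) D)
        (fun m n t F => fcomp F (dmap_functor t)) _ _.
Next Obligation.
move=> D n F; apply: (@functor_eq _ _ (fcomp F (dmap_functor (did n))) F (fun=> erefl)) => i j h.
by rewrite hcast_id /=; congr fhom; apply: (@Prop_irrelevance (_ <= _)).
Qed.
Next Obligation.
move=> D m n p t s F.
apply: (@functor_eq _ _ (fcomp F (dmap_functor (dcomp t s)))
  (fcomp (fcomp F (dmap_functor t)) (dmap_functor s)) (fun=> erefl)) => i j h.
by rewrite hcast_id /=; congr fhom; apply: (@Prop_irrelevance (_ <= _)).
Qed.

Program Definition nerve_map (C D : category) (F : functor C D) :
  smap (nerve C) (nerve D) := @SMap _ _ (fun n G => fcomp F G) _.
Next Obligation.
move=> C D F m n t G.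
by apply: (@functor_eq _ _ (fcomp F (fcomp G (dmap_functor t)))
  (fcomp (fcomp F G) (dmap_functor t)) (fun=> erefl)).
Qed.

Lemma edge_eq (X : sset) (x y : X 0) (e e' : edge x y) :
  edge_cell e = edge_cell e' -> e = e'.
Proof.
case: e e' => [c p q] [c' p' q'] /= E; subst c'.
by congr Edge; exact: Prop_irrelevance.
Qed.

Lemma hcast_ho_edge (X : sset) (x y x' y' : ho X) (ex : x = x') (ey : y = y')
    (e : @edge X x y) (e' : @edge X x' y') :
  edge_cell e = edge_cell e' -> hcast ex ey (ho_edge e) = ho_edge e'.
Proof. by move=> E; subst x' y'; rewrite hcast_id (edge_eq E). Qed.

Lemma ho_edge_degen (X : sset) (x : X 0) (e : edge x x) :
  edge_cell e = degen x -> ho_edge e = cid (x : ho X).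
Proof. by move=> h; apply/clsP; exact: path_rel_degen. Qed.

Lemma ho_edge_triangle (X : sset) (x y z : X 0) (s : X 2) (e01 : edge x y)
    (e12 : edge y z) (e02 : edge x z) :
  act (@dface 1 ord_max) s = edge_cell e01 ->
  act (@dface 1 ord0) s = edge_cell e12 ->
  act (@dface 1 (@Ordinal 3 1 isT)) s = edge_cell e02 ->
  ho_edge e12 \oc ho_edge e01 = ho_edge e02.
Proof.
move=> h1 h2 h3; rewrite /= ho_compE /=; apply/clsP.
exact: path_rel_triangle h1 h2 h3.
Qed.

Lemma cls_cons (X : sset) (x y z : X 0) (e : edge x y) (p : epath y z) :
  cls (pcons e p) = (cls p : @chom (ho X) y z) \oc ho_edge e.
Proof. by rewrite /= ho_compE. Qed.

Program Definition dedge n (i j : 'I_n.+1) (h : i <= j) : dmap 1 n :=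
  @DMap 1 n (fun k : 'I_2 => if k == ord0 then i else j) _.
Next Obligation.
by move=> n i j h [[|[|k]] hk] [[|[|l]] hl].
Qed.

Section NerveUnit.
Variable X : sset.

Program Definition unit_edge n (x : X n) (i j : 'I_n.+1) (h : i <= j) :
    @edge X (act (dconst 0 i) x) (act (dconst 0 j) x) :=
  @Edge X _ _ (act (dedge h) x) _ _.
Next Obligation.
by move=> *; rewrite -actM; congr act; apply: dmap_eq => -[[|k] hk].
Qed.
Next Obligation.
by move=> *; rewrite -actM; congr act; apply: dmap_eq => -[[|k] hk].
Qed.

Program Definition unit_cell n (x : X n) : nerve (ho X) n :=
  @Functor (ord_category n) (ho X) (fun i => act (dconst 0 i) x)
     (fun i j h => ho_edge (unit_edge x h)) _ _.
Next Obligation.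
move=> n x i; apply: ho_edge_degen; rewrite /degen /= -actM; congr act.
by apply: dmap_eq => k /=; case: eqP.
Qed.
Next Obligation.
move=> n x i j k jk ij.
have mono : forall a b : 'I_3, a <= b ->
  (if val a == 0 then i else if val a == 1 then j else k)
     <= (if val b == 0 then i else if val b == 1 then j else k).
  have ik := leq_trans ij jk.
  by move=> [[|[|[|a]]] ha] [[|[|[|b]]] hb].
apply/esym; apply: (@ho_edge_triangle _ _ _ _ (act (DMap mono) x)) => /=;
  rewrite -actM; congr act; apply: dmap_eq => -[[|[|a]] ha] //.
Qed.

Program Definition nerve_unit : smap X (nerve (ho X)) :=
  @SMap _ _ unit_cell _.
Next Obligation.
move=> m n t x.
have e i : unit_cell (act t x) i = act t (unit_cell x) i.
  by rewrite /= -actM; congr act; apply: dmap_eq.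
apply: (@functor_eq _ _ _ _ e) => i j h.
apply: hcast_ho_edge; rewrite /= -actM; congr act; apply: dmap_eq => k /=.
by case: eqP.
Qed.

End NerveUnit.

Lemma nerve_unit_natural (X Y : sset) (u : smap X Y) :
  scomp (nerve_map (ho_map u)) (nerve_unit X) = scomp (nerve_unit Y) u.
Proof.
apply: smap_eq => n x.
have e i : fobj (sfun (scomp (nerve_map (ho_map u)) (nerve_unit X)) x : functor _ _) i
  = fobj (sfun (scomp (nerve_unit Y) u) x : functor _ _) i by exact: snat.
apply: (functor_eq (e := e)) => i j h.
by rewrite /= ho_map_homE; apply: hcast_ho_edge; rewrite /= snat.
Qed.

Lemma fhom_hcast (C D : category) (F : functor C D) (x y x' y' : C)
    (ex : x = x') (ey : y = y') (u : chom x y) :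
  fhom F (hcast ex ey u) = hcast (congr1 F ex) (congr1 F ey) (fhom F u).
Proof. by subst; rewrite !hcast_id. Qed.

Section Universal.
Variables (X : sset) (D : category) (u : smap X (nerve D)).

Let uob (x : X 0) : D := fobj (u 0 x : functor _ _) ord0.

Lemma u_ob n (x : X n) (i : 'I_n.+1) :
  fobj (u n x : functor _ _) i = uob (act (dconst 0 i) x).
Proof. by rewrite /uob snat. Qed.

Lemma u_ob1 (x y : X 0) (e : edge x y) (k : 'I_2) :
  fobj (u 1 e : functor _ _) k = uob (if k == ord0 then x else y).
Proof.
rewrite u_ob; congr uob; case: eqP => [->|/eqP k0].
  by apply: etrans (edge_src e); congr act; apply: dmap_eq => -[[|i] hi] //; apply/val_inj.
apply: etrans (edge_tgt e); congr act; apply: dmap_eq => -[[|i] hi] //; apply/val_inj.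
by move: k k0 => [[|[|]]].
Qed.

Definition uedge (x y : X 0) (e : edge x y) : chom (uob x) (uob y) :=
  hcast (u_ob1 e ord0) (u_ob1 e ord_max)
    (@fhom _ _ (u 1 e : functor _ _) ord0 ord_max (leq0n 1)).

Lemma poset_hcast n (G : functor (ord_category n) D) (i j i' j' : 'I_n.+1)
  (h : i <= j) (h' : i' <= j') (ei : G i = G i') (ej : G j = G j') :
  i = i' -> j = j' -> hcast ei ej (@fhom _ _ G i j h) = @fhom _ _ G i' j' h'.
Proof. by move=> *; subst; rewrite hcast_id (Prop_irrelevance h h'). Qed.

Lemma uedgeE n (s : X n) (x y : X 0) (e : edge x y) (t : dmap 1 n)
    (i j : 'I_n.+1) (h : i <= j)
    (ei : fobj (u n s : functor _ _) i = uob x)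
    (ej : fobj (u n s : functor _ _) j = uob y) :
  act t s = edge_cell e -> t ord0 = i -> t ord_max = j ->
  uedge e = hcast ei ej (@fhom _ _ (u n s : functor _ _) i j h).
Proof.
move=> E ti tj; subst i j; rewrite /uedge.
have E' : fcomp (u n s) (dmap_functor t) = u 1 e by rewrite -E snat.
have h2 k : fobj (fcomp (u n s) (dmap_functor t)) k = fobj (u 1 e : functor _ _) k.
  by rewrite E'.
rewrite -(@functor_eq_hom _ _ _ _ _ _ (h2 ord0) (h2 ord_max) _ E') /=.
rewrite hcast_trans (Prop_irrelevance (dmono t _) h).
exact: hcast_irr.
Qed.

Fixpoint upath (x y : X 0) (p : epath x y) : chom (uob x) (uob y) :=
  match p with
  | pnil x => cid (uob x)
  | pcons _ _ _ e p' => upath p' \oc uedge e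
  end.

Lemma upath_cat x y z (p : epath x y) (q : epath y z) :
  upath (pcat p q) = upath q \oc upath p.
Proof.
by elim: p q => [x' q|x' y' z' e p IH q] /=; rewrite ?ccomp1r // IH ccompA.
Qed.

Lemma upath_rel x y (p q : epath x y) : path_rel p q -> upath p = upath q.
Proof.
elim=> {x y p q} //=.
- by move=> x y p q r _ -> _ ->.
- by move=> x y z e p q _ ->.
- move=> x y e p he.
  have H (k : 'I_1) : fobj (u 0 x : functor _ _) k = uob x by rewrite ord1.
  rewrite (@uedgeE 0 x x x e (dconst 1 ord0) ord0 ord0 (leqnn _) (H _) (H _)) //.
  have -> : @fhom _ _ (u 0 x : functor _ _) ord0 ord0 (leqnn _) = cid _.
    by rewrite -fhom1; congr fhom; apply: (@Prop_irrelevance (_ <= _)).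
  by rewrite hcast_cid ccomp1r.
- move=> x y z t s e01 e12 e02 p h01 h12 h02.
  pose o1 := @Ordinal 3 1 isT.
  have H0 : fobj (u 2 s : functor _ _) ord0 = uob x.
    rewrite u_ob; congr uob; apply: etrans (edge_src e01); rewrite -h01 -actM; congr act.
    by apply: dmap_eq => -[[|k] hk] //; apply/val_inj.
  have H1 : fobj (u 2 s : functor _ _) o1 = uob y.
    rewrite u_ob; congr uob; apply: etrans (edge_src e12); rewrite -h12 -actM; congr act.
    by apply: dmap_eq => -[[|k] hk] //; apply/val_inj.
  have H2 : fobj (u 2 s : functor _ _) ord_max = uob z.
    rewrite u_ob; congr uob; apply: etrans (edge_tgt e12); rewrite -h12 -actM; congr act.
    by apply: dmap_eq => -[[|k] hk] //; apply/val_inj.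
  rewrite (@uedgeE 2 s x y e01 _ ord0 o1 isT H0 H1 h01); try exact/val_inj.
  rewrite (@uedgeE 2 s y z e12 _ o1 ord_max isT H1 H2 h12); try exact/val_inj.
  rewrite (@uedgeE 2 s x z e02 _ ord0 ord_max isT H0 H2 h02); try exact/val_inj.
  rewrite -ccompA -hcast_comp -fhomM; congr (_ \oc hcast _ _ _).
  by congr fhom; apply: (@Prop_irrelevance (_ <= _)).
Qed.

Program Definition nerve_lift : functor (ho X) D :=
  @Functor (ho X) D uob (fun x y c => upath (ho_repr c)) _ _.
Next Obligation. by move=> x; exact: upath_rel (path_rel_repr (pnil x)). Qed.
Next Obligation.
move=> x y z v w; rewrite -upath_cat.
exact: upath_rel (path_rel_repr (pcat (ho_repr w) (ho_repr v))).
Qed.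

Lemma nerve_liftE x y (p : epath x y) :
  fhom nerve_lift (cls p : @chom (ho X) x y) = upath p.
Proof. exact: upath_rel (path_rel_repr p). Qed.

(** [ho] is left adjoint to the nerve: [nerve_unit] is natural and each
    [nerve_unit X] is a universal arrow from [X] to [nerve]. *)
Theorem ho_nerve_universal :
  exists! F : functor (ho X) D, scomp (nerve_map F) (nerve_unit X) = u.
Proof.
exists nerve_lift; split.
  apply: smap_eq => n x.
  have e i : fobj (sfun (scomp (nerve_map nerve_lift) (nerve_unit X)) x : functor _ _) i
    = fobj (u n x : functor _ _) i by rewrite u_ob.
  apply: (functor_eq (e := e)) => i j h.
  rewrite [X in hcast _ _ X]nerve_liftE /= ccomp1l.
  rewrite (@uedgeE n x _ _ _ (dedge h) i j h (u_ob x i) (u_ob x j)) //.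
  by rewrite hcast_trans hcast_id.
move=> F E.
have e x : nerve_lift x = F x.
  rewrite /= /uob -E /=; congr fobj; rewrite -[RHS]act1; congr act.
  by apply: dmap_eq => i /=; rewrite ord1.
have eE x y (a : edge x y) : hcast (e x) (e y) (uedge a) = fhom F (ho_edge a).
  have h k : fobj (sfun (scomp (nerve_map F) (nerve_unit X)) (edge_cell a) : functor _ _) k
    = fobj (u 1 a : functor _ _) k by rewrite E.
  have E' := congr1 (fun v : smap X (nerve D) => v 1 (edge_cell a)) E.
  rewrite /uedge -(@functor_eq_hom _ _ _ _ _ _ (h ord0) (h ord_max) _ E').
  rewrite !hcast_trans.
  set e1 := etrans _ _; set e2 := etrans _ _.
  have f1 : act (dconst 0 ord0) (edge_cell a) = x.
    rewrite -[RHS](edge_src a); congr act.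
    by apply: dmap_eq => -[[|k] hk] //; apply/val_inj.
  have f2 : act (dconst 0 ord_max) (edge_cell a) = y.
    rewrite -[RHS](edge_tgt a); congr act.
    by apply: dmap_eq => -[[|k] hk] //; apply/val_inj.
  have <- : hcast (f1 : _ = x :> ho X) (f2 : _ = y :> ho X)
     (ho_edge (unit_edge (edge_cell a) (leq0n 1 : (ord0 : 'I_2) <= (ord_max : 'I_2)))) = ho_edge a.
    apply: hcast_ho_edge; rewrite /= -[RHS]act1; congr act.
    by apply: dmap_eq => -[[|[|k]] hk] //=; apply/val_inj.
  by rewrite fhom_hcast; apply: hcast_irr.
apply: (functor_eq (e := e)) => x y c.
rewrite -(ho_reprK c) nerve_liftE; elim: (ho_repr c) => {x y c} [x|x y z a p IH].
  by rewrite /= hcast_cid -(fhom1 F).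
by rewrite /= (hcast_comp _ (e y)) IH eE -fhomM -cls_cons.
Qed.

End Universal.

(** hom'(X, Y) = h(Y^X). A functor X -> Y is, as an object of [qhom X Y], a
    vertex of Y^X, through [vertex_of] and [map_of]. *)
Definition qhom (X Y : sset) : category := ho (sexp X Y).

Definition qhom_post (X Y Y' : sset) (f : smap Y Y') :
  functor (qhom X Y) (qhom X Y') := ho_map (sexp_post X f).

Definition qhom_pre (X X' : sset) (a : smap X X') (Y : sset) :
  functor (qhom X' Y) (qhom X Y) := ho_map (sexp_pre a Y).

Lemma qhom_pre_post (X Y Z : sset) (f : smap Y Z) (a : qhom X Y) :
  qhom_pre (map_of a) Z (vertex_of f) = qhom_post X f a.
Proof.
by apply: smap_eq => n [x s] /=; congr sfun; congr sfun; congr pair; exact: dmap0.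
Qed.

Lemma ho_mapM (X Y Z : sset) (v : smap Y Z) (u : smap X Y) :
  ho_map (scomp v u) = fcomp (ho_map v) (ho_map u).
Proof.
apply: (@functor_eq _ _ (ho_map (scomp v u)) (fcomp (ho_map v) (ho_map u)) (fun=> erefl)).
move=> x y c; rewrite hcast_id -(ho_reprK c) /= !ho_map_homE; congr cls.
elim: (ho_repr c) => //= {c} {}x {}y z e p ->.
by congr pcons; exact: edge_eq.
Qed.

Lemma sexp_postM (X Y Y' Y'' : sset) (g : smap Y' Y'') (f : smap Y Y') :
  sexp_post X (scomp g f) = scomp (sexp_post X g) (sexp_post X f).
Proof. by apply: smap_eq => n a; exact: smap_eq. Qed.

Program Definition sexp_comp (X Y Z : sset) :
    smap (sprod (sexp Y Z) (sexp X Y)) (sexp X Z) :=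
  @SMap (sprod (sexp Y Z) (sexp X Y)) (sexp X Z)
    (fun n p => scomp p.1 (spair p.2 (ssnd X (simplex n)))) _.
Next Obligation. by move=> *; exact: smap_eq. Qed.

Section Interchange.
Variables X Y Z : sset.

Let P := qhom Y Z.
Let Q := qhom X Y.

Let Fa (a : Q) : functor P (qhom X Z) := qhom_pre (map_of a) Z.
Let Gv (v : P) : functor Q (qhom X Z) := qhom_post X (map_of v).

Lemma whisker_obj (v : P) (a : Q) : Fa a v = Gv v a.
Proof.
apply: smap_eq => n [x s] /=; congr sfun; congr pair; last exact: dmap0.
by congr sfun; congr pair; exact: dmap0.
Qed.

Let natural (v w : P) (psi : chom v w) (a b : Q) (tau : chom a b) : Prop :=
  fhom (Gv w) tau \oc hcast (whisker_obj v a) (whisker_obj w a) (fhom (Fa a) psi)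
  = hcast (whisker_obj v b) (whisker_obj w b) (fhom (Fa b) psi) \oc fhom (Gv v) tau.

Lemma natural_edge (v w : P) (e : @edge (sexp Y Z) v w) (a b : Q)
  (t : @edge (sexp X Y) a b) : natural (ho_edge e) (ho_edge t).
Proof.
have edgeE (c : Q) : exists2 k : @edge (sexp X Z) (Gv v c) (Gv w c),
    edge_cell k = @sfun _ _ (sexp_comp X Y Z) 1 (edge_cell e, degen c)
  & hcast (whisker_obj v c) (whisker_obj w c) (fhom (Fa c) (ho_edge e)) = ho_edge k.
  pose k' := edge_map (sexp_pre (map_of c) Z) e.
  pose k := @Edge (sexp X Z) (Gv v c) (Gv w c) k'
    (etrans (edge_src k') (whisker_obj v c)) (etrans (edge_tgt k') (whisker_obj w c)).
  exists k.
    apply: smap_eq => n [x s] /=; congr sfun; congr pair.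
  by rewrite /= ho_map_homE; exact: hcast_ho_edge.
have edgeG (u : P) :
    edge_cell (edge_map (sexp_post X (map_of u)) t)
    = @sfun _ _ (sexp_comp X Y Z) 1 (degen u, edge_cell t).
  by apply: smap_eq => n [x s]; rewrite /degen /=; congr sfun; congr pair; exact: dmap0.
have [ka kaE ea] := edgeE a; have [kb kbE eb] := edgeE b.
have et u : fhom (Gv u) (ho_edge t) = ho_edge (edge_map (sexp_post X (map_of u)) t).
  by rewrite /= ho_map_homE.
rewrite /natural ea eb !et.
have pE m n (th : dmap m n) (x : sexp Y Z n) (y : sexp X Y n) :
  act th ((x, y) : sprod _ _ n) = (act th x, act th y) by [].
pose d := @Edge (sexp X Z) (Gv v a) (Gv w b)
  (@sfun _ _ (sexp_comp X Y Z) 1 (edge_cell e, edge_cell t)).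
have ds : act (@dface 0 ord_max) (@sfun _ _ (sexp_comp X Y Z) 1 (edge_cell e, edge_cell t))
   = Gv v a.
  rewrite -snat pE (edge_src e) (edge_src t).
  by apply: smap_eq => n [x s] /=; congr sfun; congr pair; exact: dmap0.
have dt : act (@dface 0 ord0) (@sfun _ _ (sexp_comp X Y Z) 1 (edge_cell e, edge_cell t))
   = Gv w b.
  rewrite -snat pE (edge_tgt e) (edge_tgt t).
  by apply: smap_eq => n [x s] /=; congr sfun; congr pair; exact: dmap0.
pose o1 := @Ordinal 3 1 isT.
have m1 : forall i j : 'I_3, i <= j -> (if val i == 0 then ord0 else ord_max : 'I_2)
    <= (if val j == 0 then ord0 else ord_max : 'I_2).
  by move=> [[|[|[|i]]] hi] [[|[|[|j]]] hj].
have m2 : forall i j : 'I_3, i <= j -> (if val i == 2 then ord_max else ord0 : 'I_2)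
    <= (if val j == 2 then ord_max else ord0 : 'I_2).
  by move=> [[|[|[|i]]] hi] [[|[|[|j]]] hj].
pose r1 := DMap m1; pose r2 := DMap m2.
have E1 : dcomp r1 (@dface 1 ord_max) = did 1.
  by apply: dmap_eq => -[[|[|i]] hi] //; apply/val_inj.
have E2 : dcomp r1 (@dface 1 ord0) = dcomp (@dface 0 ord0) (dconst 1 ord0).
  by apply: dmap_eq => -[[|[|i]] hi] //; apply/val_inj.
have E3 : dcomp r1 (@dface 1 o1) = did 1.
  by apply: dmap_eq => -[[|[|i]] hi] //; apply/val_inj.
have E4 : dcomp r2 (@dface 1 ord_max) = dcomp (@dface 0 ord_max) (dconst 1 ord0).
  by apply: dmap_eq => -[[|[|i]] hi] //; apply/val_inj.
have E5 : dcomp r2 (@dface 1 ord0) = did 1.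
  by apply: dmap_eq => -[[|[|i]] hi] //; apply/val_inj.
have E6 : dcomp r2 (@dface 1 o1) = did 1.
  by apply: dmap_eq => -[[|[|i]] hi] //; apply/val_inj.
rewrite (@ho_edge_triangle _ _ _ _ (@sfun _ _ (sexp_comp X Y Z) 2
   (act r1 (edge_cell e), act r2 (edge_cell t))) ka _ (d ds dt)).
- apply/esym; apply: (@ho_edge_triangle _ _ _ _ (@sfun _ _ (sexp_comp X Y Z) 2
   (act r2 (edge_cell e), act r1 (edge_cell t)))).
  + rewrite edgeG -snat pE; congr sfun; congr pair.
      by rewrite -actM E4 actM (edge_src e).
    by rewrite -actM E1 act1.
  + rewrite kbE -snat pE; congr sfun; congr pair.
      by rewrite -actM E5 act1.
    by rewrite -actM E2 actM (edge_tgt t).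
  + by rewrite -snat pE; congr sfun; congr pair; rewrite -actM ?E6 ?E3 act1.
- rewrite kaE -snat pE; congr sfun; congr pair.
    by rewrite -actM E1 act1.
  by rewrite -actM E4 actM (edge_src t).
- rewrite edgeG -snat pE; congr sfun; congr pair.
    by rewrite -actM E2 actM (edge_tgt e).
  by rewrite -actM E5 act1.
- by rewrite -snat pE; congr sfun; congr pair; rewrite -actM ?E6 ?E3 act1.
Qed.

Lemma interchange (v w : P) (psi : chom v w) (a b : Q) (tau : chom a b) :
  natural psi tau.
Proof.
rewrite -(ho_reprK psi) -(ho_reprK tau).
elim: (ho_repr psi) => {v w psi} [v|v v' w e p IHp].
  by rewrite /natural !fhom1 !hcast_cid ccomp1l ccomp1r.
suff H (r : epath a b) : natural (ho_edge e) (cls r).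
  rewrite /natural (cls_cons e p) !fhomM.
  rewrite (hcast_comp _ (whisker_obj v' a)) (hcast_comp _ (whisker_obj v' b)).
  by rewrite ccompA IHp -!ccompA H.
elim: r {tau p IHp} => {a b} [a|a a' b t r IHr].
  by rewrite /natural !fhom1 ccomp1l ccomp1r.
rewrite /natural (cls_cons t r) !fhomM -ccompA natural_edge ccompA.
by rewrite IHr -ccompA.
Qed.

End Interchange.

Section Cone.
Variables (A B C : sset) (f : smap B A) (g : smap C A) (W : sset).
Variables (p1 : smap W C) (p0 : smap W B).
Variable psi :
  @chom (qhom W A) (vertex_of (scomp f p0)) (vertex_of (scomp g p1)).

Lemma cone_obj (X Y : sset) (k : smap Y A) (p : smap W Y) (a : qhom X W) :
  qhom_pre (map_of a) A (vertex_of (scomp k p))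
  = qhom_post X k (qhom_post X p a).
Proof. by rewrite qhom_pre_post; exact: smap_eq. Qed.

(** The whiskered 2-cell psi a : f p0 a => g p1 a. *)
Definition whisker (X : sset) (a : qhom X W) :
    chom (qhom_post X f (qhom_post X p0 a)) (qhom_post X g (qhom_post X p1 a)) :=
  hcast (cone_obj f p0 a) (cone_obj g p1 a) (fhom (qhom_pre (map_of a) A) psi).

Lemma whisker_natural (X : sset) (a b : qhom X W) (tau : chom a b) :
  fhom (qhom_post X g) (fhom (qhom_post X p1) tau) \oc whisker a
  = whisker b \oc fhom (qhom_post X f) (fhom (qhom_post X p0) tau).
Proof.
have postE (Y : sset) (k : smap Y A) (p : smap W Y) :
    qhom_post X (map_of (vertex_of (scomp k p)))
    = fcomp (qhom_post X k) (qhom_post X p).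
  by rewrite vertex_ofK /qhom_post sexp_postM ho_mapM.
have E (Y : sset) (k : smap Y A) (p : smap W Y) (c : qhom X W) :
    qhom_post X (map_of (vertex_of (scomp k p))) c
    = qhom_post X k (qhom_post X p c) by rewrite postE.
have := congr1 (hcast (E _ f p0 a) (E _ g p1 b)) (interchange psi tau).
rewrite (hcast_comp _ (E _ g p1 a)) (hcast_comp _ (E _ f p0 b)) !hcast_trans.
have H (Y : sset) (k : smap Y A) (p : smap W Y) :
    hcast (E _ k p a) (E _ k p b) (fhom (qhom_post X (map_of (vertex_of (scomp k p)))) tau)
    = fhom (qhom_post X k) (fhom (qhom_post X p) tau).
  exact: (@functor_eq_hom _ _ _ (fcomp (qhom_post X k) (qhom_post X p)) _ _
    (E _ k p a) (E _ k p b) _ (postE _ k p)).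
rewrite !H /whisker.
by rewrite !(hcast_irr (etrans _ _) (cone_obj _ _ _) (etrans _ _) (cone_obj _ _ _)).
Qed.

(** The functor hom'(X, W) -> hom'(X, f) \downarrow hom'(X, g),
    a |-> (p0 a, p1 a, psi a), tau |-> (p0 tau, p1 tau). *)
Program Definition cone_functor (X : sset) :
    functor (qhom X W) (comma_category (qhom_post X f) (qhom_post X g)) :=
  @Functor (qhom X W) (comma_category (qhom_post X f) (qhom_post X g))
    (fun a => @CommaObj _ _ _ (qhom_post X f) (qhom_post X g)
       (qhom_post X p0 a) (qhom_post X p1 a) (whisker a))
    (fun a b tau => @CommaHom _ _ _ (qhom_post X f) (qhom_post X g) _ _
       (fhom (qhom_post X p0) tau) (fhom (qhom_post X p1) tau)
       (whisker_natural tau)) _ _.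
Next Obligation. by move=> X a; apply: comma_hom_eq; exact: fhom1. Qed.
Next Obligation. by move=> X a b c v u; apply: comma_hom_eq; exact: fhomM. Qed.

(** [W] with the cone [(p1, p0, psi)] is a weak comma object of [f] and [g] in
    the 2-category of quasi-categories: [W] is one of its objects, and the
    comparison functors are smothering. *)
Definition weak_comma_object : Prop :=
  quasi_category W /\
  forall X : sset, quasi_category X -> smothering (cone_functor X).

End Cone.

Arguments weak_comma_object {A B C} f g {W} p1 p0 psi.

Section CommaSset.
Variables (A B C : sset) (f : smap B A) (g : smap C A).

Definition comma_sset : sset :=
  pullback (sprod_map g f) (spair (sexp_ev ord_max A) (sexp_ev ord0 A)).

Let proj : smap comma_sset (sprod C B) := pullback_fst _ _.

Definition comma_p1 : smap comma_sset C := scomp (sfst C B) proj.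
Definition comma_p0 : smap comma_sset B := scomp (ssnd C B) proj.

Definition comma_arrow : smap (sprod comma_sset (simplex 1)) A :=
  transpose (pullback_snd _ _ : smap comma_sset (sexp (simplex 1) A)).

(** [comma_arrow] is a 1-simplex of A^(comma_sset). *)
Program Definition comma_edge :
    @edge (sexp comma_sset A) (vertex_of (scomp f comma_p0))
                              (vertex_of (scomp g comma_p1)) :=
  @Edge (sexp comma_sset A) _ _ comma_arrow _ _.
Next Obligation.
apply: smap_eq => n [[[[c b] al] e] s] /=.
move: (congr1 snd e) => /= ->; congr sfun; congr pair.
by apply: dmap_eq => i; apply/val_inj; rewrite /= (ord1 (s i)).
Qed.
Next Obligation.
apply: smap_eq => n [[[[c b] al] e] s] /=.
move: (congr1 fst e) => /= ->; congr sfun; congr pair.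
by apply: dmap_eq => i; apply/val_inj; rewrite /= (ord1 (s i)).
Qed.

Definition comma_cell :
  @chom (qhom comma_sset A) (vertex_of (scomp f comma_p0))
                            (vertex_of (scomp g comma_p1)) :=
  ho_edge comma_edge.

End CommaSset.

(* Main.v *)
(** Pushout products of inner horns with arbitrary inclusions are inner anodyne:
    the missing simplices (x, s) of X x simplex n are paired with the simplices
    obtained by repeating x and inserting the vertex k into s after its last
    entry below k, and each pair is attached along an inner horn. Hence A^X and
    f|g are quasi-categories, and f|g -> C x B is an inner fibration. As (f|g)^X
    is f^X|g^X, the terminal X suffices. Surjectivity and fullness hold because
    the morphisms of the homotopy category of a quasi-category are edges, equal
    exactly when homotopic. For conservativity, fullness supplies an inverse up
    to endomorphisms over identities, which by the inner fibration property are
    squares with degenerate horizontal sides; cut along its diagonal, such a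
    square is a composite of two homotopies of edges, and these are inverted by
    filling inner horns of dimension 3. *)

From mathcomp Require Import all_boot boolp classical_sets zify.
Require Import Defs.

Set Implicit Arguments.
Unset Strict Implicit.
Unset Printing Implicit Defensive.
#[local] Obligation Tactic := idtac.

Local Open Scope qcat_scope.

(** * Extension along inner horns of a product *)

(** Since X is arbitrary, the missing simplices are not enumerated: a maximal partial map is taken
    by Zorn's lemma, and if it were not total, a missing simplex of least dimension, and then with
    the fewest vertices below [k], would admit an attachment. When [k] is inserted after position i,
    face i+1 is the missing simplex, face i has one vertex fewer below [k], and every other face is
    an insertion into a simplex of lower dimension; so exactly the inner horn at i+1 is already
    mapped. The comparison functor need not be faithful, so lifted inverses give only endomorphisms
    over identities, and these must be shown invertible. Inverting an edge in a fibre of f|g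
    directly would ask for a filler of an outer horn. On squares with one side collapsed to a point,
    an n-simplex of the fibre is an (n+1)-simplex of A, and the outer horns 0 and 2 of a triangle
    become the inner horns 1 and 2 of a 3-simplex. *)

Lemma dmapP m n (s t : dmap m n) : (forall i, s i = t i :> nat) -> s = t.
Proof. by move=> h; apply: dmap_eq => i; apply: val_inj; exact: h. Qed.

Lemma dface_factor m n (j : 'I_n.+2) (t : dmap m n.+1) :
  (forall i, t i != j) -> exists u : dmap m n, t = dcomp (dface j) u.
Proof.
move=> h.
pose v a := odflt ord0 (unlift j (t a)).
have tv a : t a = lift j (v a).
  by rewrite /v; have := h a; rewrite eq_sym => /unlift_some[b -> ->].
have mono (a b : 'I_m.+1) : a <= b -> v a <= v b.
  by move=> ab; have := dmono t ab; rewrite !tv /= leq_bump2.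
by exists (DMap mono); exact: dmap_eq.
Qed.

Lemma dface_inj m n (j : 'I_n.+2) : injective (fun u : dmap m n => dcomp (dface j) u).
Proof.
move=> u v e; apply: dmap_eq => a; apply: (@lift_inj _ j).
exact: (congr1 (fun w : dmap m n.+1 => w a) e).
Qed.

Lemma dmap_endo_inj p (u : dmap p p) : injective u -> u = did p.
Proof.
move=> inj.
have lt (a b : 'I_p.+1) : a < b -> u a < u b.
  move=> ab; rewrite ltn_neqAle dmono ?(ltnW ab) // andbT.
  by apply/eqP => /val_inj/inj e; rewrite e ltnn in ab.
have ge q : forall a : 'I_p.+1, a = q :> nat -> a <= u a.
  elim: q => [|q IH] a aq; first by rewrite aq.
  have q' : q < p.+1 by rewrite ltnW // -aq.
  by rewrite aq; apply: leq_ltn_trans (IH (Ordinal q') erefl) (lt _ _ _); rewrite /= aq.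
have le q : forall a : 'I_p.+1, p - a = q -> u a <= a.
  elim: q => [|q IH] a aq.
    by have := ltn_ord (u a); have := ltn_ord a; lia.
  have a' : a.+1 < p.+1 by lia.
  have /= := IH (Ordinal a'); have /= := lt a (Ordinal a'); lia.
apply: dmapP => a; apply/eqP; rewrite eqn_leq /=.
by rewrite (le _ a erefl) (ge _ a erefl).
Qed.

(** [t] hits every vertex other than [j], so preimages of these can be chosen, with [a] among them,
    and any such choice is monotone. A cell outside the horn thus restricts to the missing face,
    along a section through any prescribed vertex not sent to [j]. *)
Lemma dface_section m n (j : 'I_n.+2) (t : dmap m n.+1) :
  ~ horn_pred j t -> forall a, t a != j ->
  exists2 u : dmap n m, dcomp t u = dface j & exists b, u b = a.
Proof.
move=> nh a ta.
have hit (b : 'I_n.+1) : exists c, t c == lift j b.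
  apply: contrapT => no; apply: nh; exists (lift j b); first by rewrite eq_sym neq_lift.
  by move=> c; apply/negP => tc; apply: no; exists c.
pose v b := if lift j b == t a then a else xchoose (hit b).
have tv b : t (v b) = lift j b.
  rewrite /v; case: eqP => [->//|_]; exact/eqP/(xchooseP (hit b)).
have mono (b c : 'I_n.+1) : b <= c -> v b <= v c.
  rewrite leq_eqVlt => /orP[/eqP/val_inj-> //|bc].
  rewrite leqNgt; apply/negP => /ltnW/(dmono t); rewrite !tv /= leq_bump2.
  by rewrite leqNgt bc.
exists (DMap mono); first by apply: dmap_eq => b; exact: tv.
move: ta; rewrite eq_sym => /unlift_some[b tab _]; exists b.
by rewrite /= /v tab eqxx.
Qed.

(** For reasons of dimension: the section [u] is an injective endomorphism of an ordinal, hence the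
    identity. *)
Lemma not_horn_dface n (j : 'I_n.+2) (t : dmap n n.+1) :
  ~ horn_pred j t -> t = dface j.
Proof.
move=> nh; have [[c cj]|no] := pselect (exists c, t c != j).
  have [u tu _] := dface_section nh cj.
  rewrite -tu (dmap_endo_inj (u := u)) //; first exact: dmap_eq.
  move=> a b uab; apply: (@lift_inj _ j).
  by rewrite -[lift j a]/(dface j a) -[lift j b]/(dface j b) -tu /= uab.
case: nh; exists (lift j ord0); first by rewrite eq_sym neq_lift.
move=> c; apply/negP => /eqP tc; apply: no; exists c.
by rewrite tc eq_sym neq_lift.
Qed.

Program Definition ddeg p (i : nat) (ip : i <= p) : dmap p.+1 p :=
  @DMap p.+1 p (fun a => @Ordinal p.+1 (unbump i a) _) _.
Next Obligation. by move=> p i ip a; rewrite /unbump; have := ltn_ord a; lia. Qed.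
Next Obligation. by move=> p i ip a b ab; rewrite /= /unbump; lia. Qed.

(** * Insertion of a vertex into a simplex *)

Section Insertion.
Variables (p n : nat).

(** Strict at [i] and weak after it: [i] is the last entry below [v], so [s] and [v] determine it,
    and [s] may already take the value [v]. *)
Definition insertable (s : dmap p n) (i : 'I_p.+1) (v : 'I_n.+1) : Prop :=
  s i < v /\ forall l : 'I_p.+1, i < l -> v <= s l.

Definition degi (i : 'I_p.+1) : dmap p.+1 p := ddeg (ltn_ord i : i <= p).

Program Definition dins (s : dmap p n) (i : 'I_p.+1) (v : 'I_n.+1)
    (h : insertable s i v) : dmap p.+1 n :=
  @DMap p.+1 n (fun a => if a == i.+1 :> nat then v else s (degi i a)) _.
Next Obligation.
move=> s i v [h1 h2] a b ab.
have L (c : 'I_p.+2) : c < i.+1 -> s (degi i c) <= v.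
  move=> ci; apply: leq_trans (ltnW h1); apply: dmono; rewrite /= /unbump; lia.
have R (c : 'I_p.+2) : i.+1 < c -> v <= s (degi i c).
  by move=> ci; apply: h2; rewrite /= /unbump; lia.
case: ifP => ai; case: ifP => bi //.
- by apply: R; lia.
- by apply: L; lia.
- by apply: dmono; exact: dmono.
Qed.

Lemma dins_face (s : dmap p n) i v (h : insertable s i v) (j : 'I_p.+2) :
  j = i.+1 :> nat -> dcomp (dins h) (dface j) = s.
Proof.
move=> ji; apply: dmap_eq => a /=.
case: eqP => [|_]; first by rewrite /bump ji; lia.
by congr (s _); apply/val_inj; rewrite /= /unbump /bump; lia.
Qed.

Lemma degi_face (i : 'I_p.+1) (j : 'I_p.+2) :
  j = i.+1 :> nat -> dcomp (degi i) (dface j) = did p.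
Proof. by move=> ji; apply: dmapP => a /=; rewrite /unbump /bump; lia. Qed.

End Insertion.

(** * Partial maps on a product and their maximal extensions *)

Section BoxExtension.
Variables (A X : sset) (hA : quasi_category A) (S : forall m, X m -> Prop).
Hypothesis actS : forall m l (t : dmap m l) (x : X l), S x -> S (act t x).
Variables (n : nat) (k : 'I_n.+1).
Hypothesis hk : 0 < k < n.

Let T := {m : nat & (X m * dmap m n * A m)%type}.
Let pt m (x : X m) (s : dmap m n) (a : A m) : T :=
  existT (fun m => (X m * dmap m n * A m)%type) m (x, s, a).

Let dom (G : set T) m (x : X m) (s : dmap m n) : Prop := exists a, G (pt x s a).

(** Partial maps are encoded by their graphs, so that extension is inclusion of sets, the order in
    which Zorn's lemma is applied. *)
Record partial_map (G : set T) : Prop := PartialMap {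
  pmap_fun : forall m (x : X m) s a b, G (pt x s a) -> G (pt x s b) -> a = b;
  pmap_act : forall m l (t : dmap m l) (x : X l) s a,
    G (pt x s a) -> G (pt (act t x) (dcomp s t) (act t a)) }.

(** The insertion condition makes the domain closed under the pairing
    (x, s) |-> (s_i x, s with a [k] inserted after position [i]); the cells
    outside the domain then come in pairs, each attached along an inner horn. *)
Record box_map (G : set T) : Prop := BoxMap {
  box_pmap :> partial_map G;
  box_S : forall m (x : X m) s, S x -> dom G x s;
  box_horn : forall m (x : X m) s, horn_pred k s -> dom G x s;
  box_ins : forall m (x : X m) s (i : 'I_m.+1) (h : insertable s i k),
    dom G x s -> dom G (act (degi i) x) (dins h) }.

Lemma dom_act G (hG : partial_map G) m l (t : dmap m l) (x : X l) s :
  dom G x s -> dom G (act t x) (dcomp s t).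
Proof. by case=> a ha; exists (act t a); exact: pmap_act. Qed.

Lemma insertion_face G (hG : box_map G) p (x : X p) (s : dmap p n) (i : 'I_p.+1)
    (hi : insertable s i k) (j : 'I_p.+2) : 0 < p ->
  (forall q (x' : X q) s', q < p -> dom G x' s') ->
  j != i :> nat -> j != i.+1 :> nat ->
  dom G (act (dface j) (act (degi i) x)) (dcomp (dins hi) (dface j)).
Proof.
case: p x s i hi j => // q x s i hi j _ dmin ji ji1.
(* Indices of the simplicial identity d_j s_i = s_i' d_j', for j other than i and i+1: the face is
   an insertion into the face d_j' of (x, s), which has lower dimension. *)
have h1 : i - (j < i) < q.+1 by have := ltn_ord i; have := ltn_ord j; lia.
have h2 : j - (i < j) < q.+2 by have := ltn_ord j; lia.
pose i' : 'I_q.+1 := Ordinal h1.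
pose j' : 'I_q.+2 := Ordinal h2.
have fi : dface j' i' = i by apply/val_inj; rewrite /= /bump; lia.
have h' : insertable (dcomp s (dface j')) i' k.
  split=> [|l il]; first by change (s (dface j' i') < k); rewrite fi; case: hi.
  by case: hi => _ -> //; move: il; rewrite /= /bump; lia.
have := box_ins hG h' (dmin q (act (dface j') x) (dcomp s (dface j')) (leqnn _)).
rewrite -!actM.
have -> : dcomp (dface j') (degi i') = dcomp (degi i) (dface j).
  by apply: dmapP => a; rewrite /= /bump /unbump; lia.
have -> // : dins h' = dcomp (dins hi) (dface j).
apply: dmapP => a /=.
have -> : (bump j a == i.+1) = (a == i'.+1 :> nat) by rewrite /i' /bump /=; lia.
case: ifP => // ai; congr (nat_of_ord (s _)); apply/val_inj.
by move/eqP: ai; rewrite /= /bump /unbump; lia.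
Qed.

(** * Attaching one pair of missing simplices *)

Section Attach.
Variables (G : set T) (hG : box_map G).
Variables (p : nat) (x : X p) (s : dmap p n).
Hypothesis ndom : ~ dom G x s.
Hypothesis dim_min : forall q (x' : X q) s', q < p -> dom G x' s'.
Hypothesis cnt_min : forall (x' : X p) (s' : dmap p n),
  #|[pred l | s' l < k]| < #|[pred l | s l < k]| -> dom G x' s'.

(** Here 0 < k < n enters: outside the horn [s] hits the first and the last vertex, so some entry
    lies below [k], and the last such entry is followed by another. The resulting bound makes the
    horn at i+1 inner. *)
Lemma missing_insertable : exists2 i : 'I_p.+1, insertable s i k & i.+1 <= p.
Proof.
have nh : ~ horn_pred k s by move=> h; apply: ndom; exact: box_horn.
have hit j : j != k -> exists a, s a = j.
  move=> jk; apply: contrapT => no; apply: nh; exists j => // a.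
  by apply/eqP => sa; apply: no; exists a.
have [a0 ha0] : exists a, s a = ord0.
  by apply: hit; apply/eqP => e; move: hk; rewrite -e.
have [a1 ha1] : exists a, s a = ord_max.
  by apply: hit; apply/eqP => e; move: hk; rewrite -e /= ltnn andbF.
have a0k : s a0 < k by rewrite ha0; case/andP: hk.
pose i := [arg max_(i > a0 | s i < k) (i : nat)].
have [ik imax] : s i < k /\ forall j : 'I_p.+1, s j < k -> j <= i.
  by rewrite /i; case: arg_maxnP.
exists i.
  by split=> // l il; rewrite leqNgt; apply/negP => /imax; rewrite leqNgt il.
have : i < a1.
  rewrite ltnNge; apply/negP => /(dmono s); rewrite ha1 /= leqNgt.
  by case/andP: hk => _ kn; rewrite (ltn_trans ik kn).
by move=> h; apply: leq_trans h _; rewrite -ltnS.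
Qed.

Variables (i : 'I_p.+1) (hi : insertable s i k) (ip : i.+1 <= p).

Let j1 : 'I_p.+2 := inord i.+1.
Let zx := act (degi i) x.
Let zs := dins hi.

Lemma j1E : j1 = i.+1 :> nat.
Proof. by rewrite inordK // ltnS ltnW. Qed.

(** Face i of [zs] is [s] with its entry at i replaced by [k]. It has one vertex fewer below [k], so
    minimality of the count applies. *)
Lemma missing_face_degenerate (j : 'I_p.+2) :
  j = i :> nat -> dom G (act (dface j) zx) (dcomp zs (dface j)).
Proof.
move=> ji; apply: cnt_min; apply: proper_card; apply/properP; split.
  apply/fintype.subsetP => a; rewrite !inE /=.
  case: eqP => [_|ai]; first by rewrite ltnn.
  rewrite (_ : Ordinal _ = a) //; apply/val_inj; move: ai.
  by rewrite /= /unbump /bump ji; lia.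
exists i; rewrite !inE; first by case: hi.
rewrite /=; case: eqP => [_|[]]; first by rewrite ltnn.
by rewrite /bump ji; lia.
Qed.

Lemma attach_horn m (t : dmap m p.+1) :
  horn_pred j1 t -> dom G (act t zx) (dcomp zs t).
Proof.
move=> [j jj1 /dface_factor[u ->]].
suff : dom G (act (dface j) zx) (dcomp zs (dface j)).
  by move=> /(dom_act hG u); rewrite -actM; congr (dom G _ _); exact: dmap_eq.
have [ji|ji] := eqVneq (j : nat) i; first exact: missing_face_degenerate.
apply: insertion_face => //; first exact: leq_trans ip.
by apply: contra jj1 => /eqP e; apply/eqP/val_inj; rewrite /= j1E.
Qed.

Lemma attach_section m (t : dmap m p.+1) (u : dmap p m) :
  dcomp t u = dface j1 -> act u (act t zx) = x /\ dcomp (dcomp zs t) u = s.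
Proof.
move=> tu; split.
  by rewrite -actM tu /zx -actM (degi_face j1E) act1.
by rewrite -[RHS](dins_face hi j1E) -tu; exact: dmap_eq.
Qed.

Lemma attach_horn_iff m (t : dmap m p.+1) :
  dom G (act t zx) (dcomp zs t) <-> horn_pred j1 t.
Proof.
split; last exact: attach_horn.
move=> hd; apply: contrapT => nh.
have [a taj] : exists a, t a != j1.
  apply: contrapT => no; apply: nh; exists (lift j1 ord0).
    by rewrite eq_sym neq_lift.
  move=> a; apply/negP => /eqP ta; apply: no; exists a.
  by rewrite ta eq_sym neq_lift.
have [u tu _] := dface_section nh taj.
have [ex es] := attach_section tu.
by apply: ndom; rewrite -ex -es; exact: (dom_act hG u hd).
Qed.

(** This makes the values on new simplices well defined. Where [t a] differs from [j1], take a
    section of [t] through [a]; followed by [t'] it has image (x, s), which is outside the domain,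
    so it is again the missing face by [not_horn_dface], and [t'] agrees with [t] at [a]. *)
Lemma attach_inj m (t t' : dmap m p.+1) : ~ horn_pred j1 t -> ~ horn_pred j1 t' ->
  act t zx = act t' zx -> dcomp zs t = dcomp zs t' -> t = t'.
Proof.
move=> + + ex es.
have H (r r' : dmap m p.+1) a : ~ horn_pred j1 r -> act r zx = act r' zx ->
    dcomp zs r = dcomp zs r' -> r a != j1 -> r' a = r a.
  move=> nh ex' es' ra.
  have [u ru [b ub]] := dface_section nh ra.
  have [eux eus] := attach_section ru.
  have r'u : dcomp r' u = dface j1.
    apply: not_horn_dface => /attach_horn; rewrite actM -ex' eux.
    suff -> : dcomp zs (dcomp r' u) = dcomp (dcomp zs r) u by rewrite eus.
    by rewrite es'; exact: dmap_eq.
  rewrite -ub -[LHS]/(dcomp r' u b) -[RHS]/(dcomp r u b).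
  by rewrite ru r'u.
move=> nt nt'; apply: dmap_eq => a.
have [ta|ta] := eqVneq (t a) j1; last by rewrite (H _ _ _ nt ex es ta).
have [t'a|t'a] := eqVneq (t' a) j1; first by rewrite ta t'a.
by rewrite (H _ _ _ nt' (esym ex) (esym es) t'a).
Qed.

Lemma attach : exists2 G', box_map G' & (G `<` G')%classic.
Proof.
have hval m (t : dmap m p.+1) : horn_pred j1 t ->
    {a | G (pt (act t zx) (dcomp zs t) a)}.
  by move=> /attach_horn/boolp.cid.
pose hfun m (t : horn j1 m) := sval (hval _ _ (svalP t)).
have hfunP m (t : horn j1 m) : G (pt (act (sval t) zx) (dcomp zs (sval t)) (hfun m t)).
  exact: svalP (hval _ _ _).
have hnat m l (t : dmap m l) (r : horn j1 l) : hfun m (act t r) = act t (hfun l r).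
  apply: (pmap_fun hG (hfunP _ _)); have := pmap_act hG t (hfunP _ r).
  by rewrite -actM; congr (G (pt _ _ _)); exact: dmap_eq.
have j1b : 0 < j1 < p.+1 by rewrite j1E; exact: ip.
have [w hw] := hA j1b (SMap hnat).
pose z := w _ (did p.+1).
have wE m (t : dmap m p.+1) : w _ t = act t z.
  by rewrite /z -snat; congr (w _ _); exact: dmap_eq.
have zhorn m (t : dmap m p.+1) (h : horn_pred j1 t) :
    G (pt (act t zx) (dcomp zs t) (act t z)).
  pose r : horn j1 m := exist _ t h.
  have := congr1 (fun f : smap (horn j1) A => f m r) hw.
  by rewrite /= wE => ->; exact: hfunP r.
pose new m (y : X m) (r : dmap m n) (a : A m) : Prop :=
  exists t, [/\ y = act t zx, r = dcomp zs t & a = act t z].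
pose G' : set T := fun y => G y \/
  new (projT1 y) (projT2 y).1.1 (projT2 y).1.2 (projT2 y).2.
(* Old and new values cannot conflict: on the horn [z] extends the old ones, and elsewhere there are
   none. *)
have zorn m (t : dmap m p.+1) : G (pt (act t zx) (dcomp zs t) (act t z)) \/
    ~ dom G (act t zx) (dcomp zs t).
  have [h|h] := pselect (horn_pred j1 t); [left; exact: zhorn|right].
  by move/attach_horn_iff.
have domG' m (y : X m) r : dom G' y r <->
    dom G y r \/ exists t, y = act t zx /\ r = dcomp zs t.
  split=> [[a [ga|[t /= [-> -> _]]]]|[[a ga]|[t [-> ->]]]].
  - by left; exists a.
  - by right; exists t.
  - by exists a; left.
  - by exists (act t z); right; exists t.
have mixed m (y : X m) r a b : G (pt y r a) -> new m y r b -> a = b.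
  move=> + [t [ey er ->]]; rewrite {}ey {}er => ga.
  by case: (zorn m t) => [/(pmap_fun hG ga) //|[]]; exists a.
exists G'; last first.
  split; first by move=> y; left.
  move=> /(_ (pt x s (act (dface j1) z))) h; apply: ndom.
  exists (act (dface j1) z); apply: h; right; exists (dface j1).
  by rewrite (dins_face hi j1E) -actM (degi_face j1E) act1.
split.
- split.
  + move=> m y r a b [ga|na] [gb|nb].
    * exact: (pmap_fun hG ga gb).
    * exact: mixed ga nb.
    * exact/esym/(mixed _ _ _ _ _ gb na).
    * have [[c gc]|nd] := pselect (dom G y r).
        exact: etrans (esym (mixed _ _ _ _ _ gc na)) (mixed _ _ _ _ _ gc nb).
      move: na nb nd => [t /= [-> -> ->]] [t' /= [ey er ->]] nd; congr (act _ z).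
      apply: attach_inj => // /attach_horn //.
      by rewrite -ey -er.
  + move=> m l t y r a [ga|[u /= [-> -> ->]]]; first by left; exact: (pmap_act hG t ga).
    right; exists (dcomp u t); rewrite -!actM; split=> //; exact: dmap_eq.
- by move=> m y r hS; apply/domG'; left; exact: box_S.
- by move=> m y r hr; apply/domG'; left; exact: box_horn.
- move=> m y r l h /domG' hd; apply/domG'.
  have [d|nd] := pselect (dom G y r); first by left; exact: box_ins.
  right; case: hd => // -[t [ey er]]; subst y r.
  have nt : ~ horn_pred j1 t by move/attach_horn.
  have [a ta] : exists a, t a = i :> nat.
    apply: contrapT => no; apply: nt; exists (inord i).
      by apply/eqP => /(congr1 val); rewrite /= j1E inordK; [lia|exact: leqW].
    move=> a; apply/eqP => /(congr1 val) /=; rewrite inordK; last exact: leqW.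
    by move=> e; apply: no; exists a.
  have zs_gt (b : 'I_p.+2) : i < b -> k <= zs b.
    move=> ib; rewrite /=; case: ifP => // bi.
    by case: hi => _; apply; rewrite /= /unbump; lia.
  have zs_le (b : 'I_p.+2) : b <= i -> zs b < k.
    move=> bi; rewrite /=; case: ifP => [|_]; first by lia.
    case: hi => h1 _; apply: leq_ltn_trans h1; apply: dmono.
    by rewrite /= /unbump; lia.
  case: (h) => hl1 hl2.
  have tl : t l = i :> nat.
    apply/eqP; rewrite eqn_leq; apply/andP; split.
      by rewrite leqNgt; apply/negP => /zs_gt; rewrite leqNgt hl1.
    rewrite -ta; apply: dmono; rewrite leqNgt; apply/negP => /hl2.
    by rewrite leqNgt [dcomp zs t a]/(zs (t a)) zs_le // ta.
  (* The entries of [zs] are below [k] exactly up to i, and [t] hits i, so [l] is the last position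
     that [t] sends to i. Inserting [k] then amounts to inserting [j1] into [t], since [zs] sends
     [j1] to [k] and [degi i] merges [j1] with i. *)
  have ht : insertable t l j1.
    split=> [|b /hl2 kb]; first by rewrite tl j1E.
    rewrite j1E ltnNge; apply/negP => /zs_le; rewrite ltnNge; exact/negP/negPn.
  exists (dins ht); split.
    rewrite -!actM; congr act; apply: dmapP => b /=; case: eqP => bl.
      have e : degi l b = l by apply/val_inj; rewrite /= /unbump bl; lia.
      by change (unbump i (t (degi l b)) = unbump i j1); rewrite e tl j1E /unbump; lia.
    by [].
  apply: dmapP => b /=; case: ifP => bl; first by have /eqP -> := j1E.
  by [].
Qed.

End Attach.

Lemma box_total G : box_map G -> (forall G', (G `<` G')%classic -> ~ box_map G') ->
  forall m (x : X m) s, dom G x s.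
Proof.
move=> hG Gmax m x s; apply: contrapT => nd.
pose miss p := exists (x : X p) (s : dmap p n), ~ dom G x s.
have ex_p : exists p, `[< miss p >] by exists m; apply/asboolP; exists x, s.
case: (ex_minnP ex_p) => p /asboolP[{}x [{}s {}nd]] pmin.
pose missc c := exists (x : X p) (s : dmap p n),
  ~ dom G x s /\ #|[pred l | s l < k]| = c.
have ex_c : exists c, `[< missc c >].
  by exists #|[pred l | s l < k]|; apply/asboolP; exists x, s.
case: (ex_minnP ex_c) => c /asboolP[{nd}x [{}s [nd sc]]] cmin.
have dmin q (x' : X q) s' : q < p -> dom G x' s'.
  move=> qp; apply: contrapT => nd'; move: qp; rewrite ltnNge => /negP; apply.
  by apply: pmin; apply/asboolP; exists x', s'.
have cntmin (x' : X p) (s' : dmap p n) :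
    #|[pred l | s' l < k]| < #|[pred l | s l < k]| -> dom G x' s'.
  rewrite sc => lt; apply: contrapT => nd'; move: lt; rewrite ltnNge => /negP; apply.
  by apply: cmin; apply/asboolP; exists x', s'.
have [i hi ip] := missing_insertable hG nd.
have [G' hG' GG'] := attach hG nd dmin cntmin hi ip.
exact: Gmax GG' hG'.
Qed.

Lemma box_extension (G0 : forall m, X m -> dmap m n -> A m -> Prop) :
  (forall m (x : X m) s, (S x \/ horn_pred k s) <-> exists a, G0 m x s a) ->
  (forall m (x : X m) s a b, G0 m x s a -> G0 m x s b -> a = b) ->
  (forall m l (t : dmap m l) (x : X l) s a,
     G0 l x s a -> G0 m (act t x) (dcomp s t) (act t a)) ->
  exists F : smap (sprod X (simplex n)) A,
    forall m (x : X m) s a, G0 m x s a -> F m (x, s) = a.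
Proof.
move=> G0dom G0fun G0act.
pose K0 : set T := fun y => G0 (projT1 y) (projT2 y).1.1 (projT2 y).1.2 (projT2 y).2.
have K0box : box_map K0.
  split.
  - split=> [m x s a b|m l t x s a]; [exact: G0fun|exact: G0act].
  - by move=> m x s h; apply/G0dom; left.
  - by move=> m x s h; apply/G0dom; right.
  (* A missed vertex other than [k] is still missed after [k] is inserted. *)
  - move=> m x s i h /G0dom[hS|[j jk hj]]; apply/G0dom; [left; exact: actS|right].
    by exists j => // a /=; case: ifP => // _; rewrite eq_sym.
(* [Zorn_bigcup] also quantifies over the empty chain, whose union is empty; adjoining [K0] makes
   the property hold there. *)
pose P (G : set T) := box_map (K0 `|` G)%classic.
have domS (G G' : set T) m (x : X m) s : (G `<=` G')%classic -> dom G x s -> dom G' x s.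
  by move=> GG' [a ga]; exists a; exact: GG'.
have chain (F : set (set T)) : (F `<=` P)%classic -> total_on F subset ->
    P (\bigcup_(Z in F) Z)%classic.
  move=> FP Ftot; set U := (\bigcup_(Z in F) Z)%classic.
  have K0U : (K0 `<=` (K0 `|` U))%classic by move=> y; left.
  have ZU Z : F Z -> ((K0 `|` Z) `<=` (K0 `|` U))%classic.
    by move=> FZ y [|zy]; [left|right; exists Z].
  have stage y : (K0 `|` U)%classic y ->
      exists G, [/\ box_map G, (G `<=` K0 `|` U)%classic & G y].
    case=> [k0|[Z FZ Zy]]; first by exists K0.
    by exists (K0 `|` Z)%classic; split; [exact: FP|exact: ZU|right].
  have stage2 y y' : (K0 `|` U)%classic y -> (K0 `|` U)%classic y' ->
      exists G, [/\ box_map G, G y & G y'].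
    case=> [k0|[Z FZ Zy]] [k0'|[Z' FZ' Zy']].
    - by exists K0.
    - by exists (K0 `|` Z')%classic; split; [exact: FP|left|right].
    - by exists (K0 `|` Z)%classic; split; [exact: FP|right|left].
    - have [ZZ'|Z'Z] := Ftot _ _ FZ FZ'.
        by exists (K0 `|` Z')%classic; split; [exact: FP|right; exact: ZZ'|right].
      by exists (K0 `|` Z)%classic; split; [exact: FP|right|right; exact: Z'Z].
  split.
  - split=> [m x s a b ha hb|m l t x s a /stage[G [hG GU ga]]].
      by have [G [hG ga gb]] := stage2 _ _ ha hb; exact: (pmap_fun hG ga gb).
    by apply: GU; exact: (pmap_act hG t ga).
  - by move=> m x s h; apply: domS K0U _; exact: box_S.
  - by move=> m x s h; apply: domS K0U _; exact: box_horn.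
  - move=> m x s i h [a /stage[G [hG GU ga]]].
    by apply: domS GU _; apply: box_ins => //; exists a.
have [Z [PZ Zmax]] := Zorn_bigcup chain.
set G := (K0 `|` Z)%classic in PZ.
have Gmax G' : (G `<` G')%classic -> ~ box_map G'.
  move=> [GG' nG'] hG'; apply: (Zmax G').
    split; first by move=> y zy; apply: GG'; right.
    by move=> G'Z; apply: nG' => y /G'Z; right.
  rewrite /P (_ : (K0 `|` G')%classic = G') //.
  by apply/seteqP; split=> [y [k0|//]|y]; [apply: GG'; left|right].
have total := box_total PZ Gmax.
pose F m (y : sprod X (simplex n) m) := sval (boolp.cid (total m y.1 y.2)).
have FP m y : G (pt y.1 y.2 (F m y)) by rewrite /F; case: boolp.cid.
have Fnat m l (t : dmap m l) y : F m (act t y) = act t (F l y).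
  exact: (pmap_fun PZ (FP m (act t y)) (pmap_act PZ t (FP l y))).
exists (SMap Fnat) => m x s a ga.
by apply: (pmap_fun PZ (FP m (x, s))); left.
Qed.

End BoxExtension.

(** * Quasi-categories and their homotopy categories *)

Program Definition cell_map (X : sset) n (x : X n) : smap (simplex n) X :=
  @SMap _ _ (fun _ s => act s x) _.
Next Obligation. by move=> X n x m l t s; rewrite /= actM. Qed.

Lemma cell_mapE (X : sset) n (w : smap (simplex n) X) m (s : dmap m n) :
  w m s = act s (w n (did n)).
Proof. by rewrite -snat; congr (w _ _); exact: dmap_eq. Qed.

Lemma horn_fill (X : sset) : quasi_category X -> forall n (k : 'I_n.+1), 0 < k < n ->
  forall h : smap (horn k) X,
  exists w : X n, forall m (r : horn k m), act (sval r) w = h m r.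
Proof.
move=> hX n k hk h; have [w <-] := hX n k hk h.
by exists (w n (did n)) => m r; rewrite -cell_mapE.
Qed.

Lemma quasi_category_fill (X : sset) :
  (forall n (k : 'I_n.+1), 0 < k < n -> forall h : smap (horn k) X,
     exists w : X n, forall m (r : horn k m), act (sval r) w = h m r) ->
  quasi_category X.
Proof.
move=> H n k hk h; have [w hw] := H n k hk h; exists (cell_map w).
by apply: smap_eq => m r; exact: hw.
Qed.

(** By transposition a horn in A^X is a map on X x [horn k], to which [box_extension] applies with
    [S] empty. *)
Lemma sexp_quasi_category (X A : sset) : quasi_category A -> quasi_category (sexp X A).
Proof.
move=> hA; apply: quasi_category_fill => n k hk h.
pose G0 m (x : X m) (s : dmap m n) (a : A m) : Prop :=
  exists H : horn_pred k s,
    a = sfun (h m (exist _ s H) : smap (sprod X (simplex m)) A) (x, did m).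
have [] := @box_extension A X hA (fun _ _ => False) _ n k hk G0.
- by [].
- move=> m x s; split=> [[//|H]|[a [H _]]]; last by right.
  by exists (sfun (h m (exist _ s H) : smap _ A) (x, did m)); exists H.
- move=> m x s a b [H ->] [H' ->].
  by rewrite (Prop_irrelevance H H').
- move=> m l t x s a [H ->].
  pose r : horn k l := exist _ s H.
  exists (proj2_sig (act t r)).
  transitivity (sfun (h m (act t r) : smap (sprod X (simplex m)) A)
    (act t x, did m)) => //.
  rewrite (snat h) -snat /=.
  by congr sfun; congr pair; exact: dmap_eq.
move=> F FP; exists F => m r; apply: smap_eq => l [x u] /=.
rewrite (FP l x (dcomp (sval r) u)
  (sfun (h l (act u r) : smap (sprod X _) A) (x, did l))).
  by rewrite snat /=; congr sfun; congr pair; exact: dmap_eq.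
by exists (proj2_sig (act u r)).
Qed.

(** * Horns given by their faces *)

Section HornFaces.
Variable X : sset.

Lemma dface_pullback m n (i j : 'I_n.+3) (u v : dmap m n.+1) (i' j' : 'I_n.+2) :
  i < j -> i' = i :> nat -> j'.+1 = j :> nat ->
  dcomp (dface i) u = dcomp (dface j) v ->
  exists w : dmap m n, u = dcomp (dface j') w /\ v = dcomp (dface i') w.
Proof.
move=> ij ii' jj' e.
have ev a : bump i (u a) = bump j (v a).
  exact: (congr1 (fun w : dmap m n.+2 => val (w a)) e).
have [w wu] : exists w : dmap m n, u = dcomp (dface j') w.
  apply: dface_factor => a; apply/eqP => ua; move: (ev a).
  rewrite ua /bump; lia.
exists w; split=> //; apply: dmapP => a; move: (ev a).
rewrite wu /= /bump; lia.
Qed.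

(** A cell of a horn may lie in several faces; by [dface_pullback] its value does not depend on the
    face chosen as soon as the faces agree in codimension two. *)
Lemma horn_of_faces n (k : 'I_n.+3) (c : 'I_n.+3 -> X n.+1) :
  (forall (i j : 'I_n.+3) (i' j' : 'I_n.+2), i != k -> j != k -> i < j ->
     i' = i :> nat -> j'.+1 = j :> nat ->
     act (dface j') (c i) = act (dface i') (c j)) ->
  exists h : smap (horn k) X, forall m (r : horn k m) (j : 'I_n.+3) u, j != k ->
    sval r = dcomp (dface j) u -> h m r = act u (c j).
Proof.
move=> hc.
have lt m (u v : dmap m n.+1) (i j : 'I_n.+3) : i != k -> j != k -> i < j ->
    dcomp (dface i) u = dcomp (dface j) v -> act u (c i) = act v (c j).
  move=> ik jk ij e.
  have hi : i < n.+2 by have := ltn_ord j; lia.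
  have hj : j.-1 < n.+2 by have := ltn_ord j; lia.
  have hj' : (Ordinal hj).+1 = j :> nat by rewrite /=; lia.
  have [w [-> ->]] := dface_pullback (i' := Ordinal hi) ij erefl hj' e.
  by rewrite !actM (hc i j (Ordinal hi) (Ordinal hj)).
have compat m (u v : dmap m n.+1) (i j : 'I_n.+3) : i != k -> j != k ->
    dcomp (dface i) u = dcomp (dface j) v -> act u (c i) = act v (c j).
  move=> ik jk e; have [ij|ji|/val_inj ij] := ltngtP i j; first exact: lt e.
    exact/esym/(lt _ _ _ _ _ jk ik ji).
  by subst j; rewrite (dface_inj e).
have val_ex m (r : horn k m) : exists a, forall (j : 'I_n.+3) u, j != k ->
    sval r = dcomp (dface j) u -> a = act u (c j).
  case: (svalP r) => j jk /dface_factor[u ru].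
  exists (act u (c j)) => i v ik e; apply: compat => //.
  by rewrite -ru -e.
pose h m r := sval (boolp.cid (val_ex m r)).
have hP m r j u : j != k -> sval r = dcomp (dface j) u -> h m r = act u (c j).
  by rewrite /h; case: boolp.cid => a ha /=; exact: ha.
have hnat m l (t : dmap m l) (r : horn k l) : h m (act t r) = act t (h l r).
  case: (svalP r) => j jk /dface_factor[u ru].
  by rewrite (hP _ _ _ _ jk ru) -actM; apply: hP => //=; rewrite ru; exact: dmap_eq.
by exists (SMap hnat).
Qed.

Lemma horn_face n (k j : 'I_n.+2) : j != k -> horn_pred k (dface j).
Proof. by exists j => // a; rewrite eq_sym neq_lift. Qed.

(** [c k] plays no role. *)
Lemma inner_horn_filler n (k : 'I_n.+3) (c : 'I_n.+3 -> X n.+1) :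
  quasi_category X -> 0 < k < n.+2 ->
  (forall (i j : 'I_n.+3) (i' j' : 'I_n.+2), i != k -> j != k -> i < j ->
     i' = i :> nat -> j'.+1 = j :> nat ->
     act (dface j') (c i) = act (dface i') (c j)) ->
  exists w : X n.+2, forall j, j != k -> act (dface j) w = c j.
Proof.
move=> hX hk /horn_of_faces[h hP]; have [w hw] := horn_fill hX hk h.
exists w => j jk; pose r : horn k n.+1 := exist _ (dface j) (horn_face jk).
apply: etrans (hw _ r) _.
by rewrite /= (hP _ r j (did _) jk) ?act1 //; exact: dmap_eq.
Qed.

End HornFaces.

#[local] Notation o31 := (@Ordinal 3 1 isT).
#[local] Notation o41 := (@Ordinal 4 1 isT).
#[local] Notation o42 := (@Ordinal 4 2 isT).

Section LowDimensionalHorns.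
Variables (X : sset) (hX : quasi_category X).

Lemma horn21_fill (a b : X 1) :
  act (@dface 0 ord_max) b = act (@dface 0 ord0) a ->
  exists s : X 2, act (@dface 1 ord_max) s = a /\ act (@dface 1 ord0) s = b.
Proof.
move=> e; have [i j i' j'|s hs] := @inner_horn_filler X 0 o31
  (fun i => if val i is 0 then b else a) hX isT.
  case: i j => [[|[|[|i]]] hi] [[|[|[|j]]] hj] //;
  case: i' j' => [[|[|i']] hi'] [[|[|j']] hj'] //= _ _ _ _ _.
  rewrite (_ : Ordinal hj' = ord_max); last exact/val_inj.
  by rewrite (_ : Ordinal hi' = ord0) //; exact/val_inj.
by exists s; split; apply: hs.
Qed.

Lemma horn31_fill (d0 d2 d3 : X 2) :
  act (@dface 1 o31) d0 = act (@dface 1 ord0) d2 ->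
  act (@dface 1 ord_max) d0 = act (@dface 1 ord0) d3 ->
  act (@dface 1 ord_max) d2 = act (@dface 1 ord_max) d3 ->
  exists w : X 3, [/\ act (@dface 2 ord0) w = d0, act (@dface 2 o42) w = d2
    & act (@dface 2 ord_max) w = d3].
Proof.
move=> e02 e03 e23; have [i j i' j'|s hs] := @inner_horn_filler X 1 o41
  (fun i => match val i with 0 => d0 | 3 => d3 | _ => d2 end) hX isT.
  case: i j => [[|[|[|[|i]]]] hi] [[|[|[|[|j]]]] hj] //;
  case: i' j' => [[|[|[|i']]] hi'] [[|[|[|j']]] hj'] //= _ _ _ _ _.
  - by rewrite (_ : Ordinal hj' = o31) ?e02; [congr (act (dface _) _)|]; exact/val_inj.
  - rewrite (_ : Ordinal hj' = ord_max) ?e03; last exact/val_inj.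
    by congr (act (dface _) _); exact/val_inj.
  - rewrite (_ : Ordinal hj' = ord_max) ?e23; last exact/val_inj.
    by congr (act (dface _) _); exact/val_inj.
by exists s; split; apply: hs.
Qed.

Lemma horn32_fill (d0 d1 d3 : X 2) :
  act (@dface 1 ord0) d0 = act (@dface 1 ord0) d1 ->
  act (@dface 1 ord_max) d0 = act (@dface 1 ord0) d3 ->
  act (@dface 1 ord_max) d1 = act (@dface 1 o31) d3 ->
  exists w : X 3, [/\ act (@dface 2 ord0) w = d0, act (@dface 2 o41) w = d1
    & act (@dface 2 ord_max) w = d3].
Proof.
move=> e01 e03 e13; have [i j i' j'|s hs] := @inner_horn_filler X 1 o42
  (fun i => match val i with 0 => d0 | 3 => d3 | _ => d1 end) hX isT.
  case: i j => [[|[|[|[|i]]]] hi] [[|[|[|[|j]]]] hj] //;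
  case: i' j' => [[|[|[|i']]] hi'] [[|[|[|j']]] hj'] //= _ _ _ _ _.
  - by rewrite (_ : Ordinal hj' = ord0) ?e01; [congr (act (dface _) _)|]; exact/val_inj.
  - rewrite (_ : Ordinal hj' = ord_max) ?e03; last exact/val_inj.
    by congr (act (dface _) _); exact/val_inj.
  - rewrite (_ : Ordinal hj' = ord_max) ?e13; last exact/val_inj.
    by congr (act (dface _) _); exact/val_inj.
by exists s; split; apply: hs.
Qed.

End LowDimensionalHorns.

Lemma act_dmapP (X : sset) m n n' l (t : dmap m n) (t' : dmap n l) (u : dmap m n')
    (u' : dmap n' l) (x : X l) :
  (forall i, t' (t i) = u' (u i) :> nat) -> act t (act t' x) = act u (act u' x).
Proof. by move=> e; rewrite -!actM; congr act; exact: dmapP. Qed.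

(** * Composition and homotopy of edges *)

Section Homotopy.
Variables (X : sset) (hX : quasi_category X).

Program Definition edge_refl (x : X 0) : edge x x := @Edge X x x (degen x) _ _.
Next Obligation.
by move=> x; rewrite /degen -actM -[RHS]act1; congr act; exact: dmap0.
Qed.
Next Obligation.
by move=> x; rewrite /degen -actM -[RHS]act1; congr act; exact: dmap0.
Qed.

Definition triangle (x y z : X 0) (a : edge x y) (b : edge y z) (c : edge x z) : Prop :=
  exists s : X 2, [/\ act (@dface 1 ord_max) s = a, act (@dface 1 ord0) s = b
    & act (@dface 1 o31) s = c].

Lemma ho_triangle x y z (a : edge x y) (b : edge y z) (c : edge x z) :
  triangle a b c -> ho_edge b \oc ho_edge a = ho_edge c.
Proof. by case=> s [h1 h2 h3]; exact: ho_edge_triangle h1 h2 h3. Qed.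

Lemma triangle_of_cell x y z (a : edge x y) (b : edge y z) (s : X 2) :
  act (@dface 1 ord_max) s = a -> act (@dface 1 ord0) s = b ->
  exists2 c : edge x z, triangle a b c & act (@dface 1 o31) s = c.
Proof.
move=> sa sb.
have hs : act (@dface 0 ord_max) (act (@dface 1 o31) s) = x.
  rewrite -(edge_src a) -sa; apply: act_dmapP => //; by case=> -[].
have ht : act (@dface 0 ord0) (act (@dface 1 o31) s) = z.
  rewrite -(edge_tgt b) -sb; apply: act_dmapP => //; by case=> -[].
by exists (Edge hs ht) => //; exists s.
Qed.

Lemma triangle_fill x y z (a : edge x y) (b : edge y z) :
  exists c : edge x z, triangle a b c.
Proof.
have [s [sa sb]] : exists s : X 2,
    act (@dface 1 ord_max) s = a /\ act (@dface 1 ord0) s = b.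
  by apply: (horn21_fill hX); rewrite ?edge_src ?edge_tgt.
by have [c abc _] := triangle_of_cell sa sb; exists c.
Qed.

Lemma triangle_degenl x y (a : edge x y) : triangle (edge_refl x) a a.
Proof.
exists (act (ddeg (leq0n 1)) (edge_cell a)); rewrite -!actM; split.
- apply: etrans (congr1 (@degen X) (edge_src a)); rewrite /degen -actM.
  by congr act; apply: dmapP; case=> -[|[]].
- by rewrite -[RHS]act1; congr act; apply: dmapP; case=> -[|[]].
- by rewrite -[RHS]act1; congr act; apply: dmapP; case=> -[|[]].
Qed.

Lemma triangle_degenr x y (a : edge x y) : triangle a (edge_refl y) a.
Proof.
exists (act (ddeg (leqnn 1)) (edge_cell a)); rewrite -!actM; split.
- by rewrite -[RHS]act1; congr act; apply: dmapP; case=> -[|[]].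
- apply: etrans (congr1 (@degen X) (edge_tgt a)); rewrite /degen -actM.
  by congr act; apply: dmapP; case=> -[|[]].
- by rewrite -[RHS]act1; congr act; apply: dmapP; case=> -[|[]].
Qed.

(** The four triangles are the faces of a 3-simplex with consecutive edges a, b, c. Each direction
    fills the inner horn that lacks the triangle sought: face 1 for the horn at 1, face 2 for the
    horn at 2. The calculus of homotopies below rests on this equivalence. *)
Lemma triangle_assoc x y z t (a : edge x y) (b : edge y z) (c : edge z t)
    (ab : edge x z) (bc : edge y t) (d : edge x t) :
  triangle a b ab -> triangle b c bc -> triangle a bc d <-> triangle ab c d.
Proof.
move=> [s3 [s3a s3b s3c]] [s0 [s0a s0b s0c]]; split=> -[s [sa sb sc]].
  have [|||w [w0 w2 w3]] := horn31_fill hX (d0 := s0) (d2 := s) (d3 := s3).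
  - by rewrite s0c sb.
  - by rewrite s0a s3b.
  - by rewrite sa s3a.
  exists (act (@dface 2 o41) w); split.
  - by rewrite -s3c -w3; apply: act_dmapP => //; case=> -[|[]].
  - by rewrite -s0b -w0; apply: act_dmapP => //; case=> -[|[]].
  - by rewrite -sc -w2; apply: act_dmapP => //; case=> -[|[]].
have [|||w [w0 w1 w3]] := horn32_fill hX (d0 := s0) (d1 := s) (d3 := s3).
- by rewrite s0b sb.
- by rewrite s0a s3b.
- by rewrite sa s3c.
exists (act (@dface 2 o42) w); split.
- by rewrite -s3a -w3; apply: act_dmapP => //; case=> -[|[]].
- by rewrite -s0c -w0; apply: act_dmapP => //; case=> -[|[]].
- by rewrite -sc -w1; apply: act_dmapP => //; case=> -[|[]].
Qed.

Definition homotopic (x y : X 0) (a b : edge x y) := triangle a (edge_refl y) b.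

(** Associativity with a degenerate last edge; it says that composites are unique up to homotopy. *)
Lemma triangle_uniq x y z (a : edge x y) (b : edge y z) (c d : edge x z) :
  triangle a b c -> triangle a b d <-> homotopic c d.
Proof. by move=> abc; exact: triangle_assoc abc (triangle_degenr b). Qed.

Lemma homotopic_refl x y (a : edge x y) : homotopic a a.
Proof. exact: triangle_degenr. Qed.

Lemma homotopic_sym x y (a b : edge x y) : homotopic a b -> homotopic b a.
Proof. by move=> h; exact: (proj1 (triangle_uniq a h) (homotopic_refl a)). Qed.

Lemma homotopic_trans x y (a b c : edge x y) :
  homotopic a b -> homotopic b c -> homotopic a c.
Proof. by move=> ab bc; apply/(triangle_uniq c ab). Qed.

(** Invariance of this predicate under [path_rel] turns an equality of classes
    in [ho X] into a homotopy. *)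
Fixpoint composite (x y : X 0) (p : epath x y) : edge x y -> Prop :=
  match p in epath x y return edge x y -> Prop with
  | pnil x => fun e => homotopic (edge_refl x) e
  | pcons _ _ _ a p' => fun e => exists2 b, composite p' b & triangle a b e
  end.

Lemma composite_homotopic x y (p : epath x y) e e' :
  composite p e -> homotopic e e' -> composite p e'.
Proof.
case: p e e' => [z|z t u a p] e e' /=; first exact: homotopic_trans.
by move=> [b pb abe] ee'; exists b => //; apply/(triangle_uniq _ abe).
Qed.

Lemma composite_rel x y (p q : epath x y) : path_rel p q ->
  forall e, composite p e <-> composite q e.
Proof.
elim=> {x y p q} //=.
- by move=> x y p q _ IH e; rewrite IH.
- by move=> x y p q r _ IH1 _ IH2 e; rewrite IH1.
- by move=> x y z a p q _ IH e; split=> -[b /IH]; exists b.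
- move=> x y a p ax e; have -> : a = edge_refl x by exact: edge_eq.
  split=> [[b pb]|pe].
    move/(triangle_uniq _ (triangle_degenl b)); exact: composite_homotopic.
  by exists e => //; exact: triangle_degenl.
- move=> x y z t s a b c p sa sb sc e.
  have abc : triangle a b c by exists s.
  split=> [[d [b' pb' td] te]|[b' pb' te]].
    by exists b' => //; apply/(triangle_assoc e abc td).
  have [d td] := triangle_fill b b'.
  by exists d; [exists b'|apply/(triangle_assoc e abc td)].
Qed.

Lemma ho_edge_homotopic x y (a b : edge x y) :
  ho_edge a = ho_edge b <-> homotopic a b.
Proof.
split; last by move/ho_triangle <-; rewrite ho_edge_degen // ccomp1l.
move/clsP/composite_rel => H.
have [e re bea] : composite (pcons b (pnil y)) a.
  by apply/H; exists (edge_refl y); exact: homotopic_refl.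
by apply: homotopic_sym; apply/(triangle_assoc a (homotopic_refl b) re).
Qed.

Lemma ho_edge_surj x y (c : @chom (ho X) x y) : exists a : edge x y, c = ho_edge a.
Proof.
rewrite -(ho_reprK c); elim: (ho_repr c) => {x y c} [x|x y z a p [b pb]].
  by exists (edge_refl x); rewrite ho_edge_degen.
have [d /ho_triangle abd] := triangle_fill a b.
by exists d; rewrite cls_cons pb.
Qed.

End Homotopy.

(** * Comma quasi-categories *)

Section Square.
Variables (A : sset) (sa sb : A 2).
Hypothesis sab : act (@dface 1 o31) sa = act (@dface 1 o31) sb.

(** On each nondegenerate triangle of the square the sum of the coordinates numbers the vertices 0,
    1, 2, so one formula serves for both. *)
Program Definition dadd m (s t : dmap m 1) : dmap m 2 :=
  @DMap m 2 (fun i => @Ordinal 3 (s i + t i) _) _.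
Next Obligation.
by move=> m s t i; have := ltn_ord (s i); have := ltn_ord (t i); lia.
Qed.
Next Obligation. by move=> m s t i j ij; rewrite /= leq_add ?dmono. Qed.

Lemma dmap1_total m (s t : dmap m 1) :
  (forall i, s i <= t i) \/ (forall i, t i <= s i).
Proof.
have [|/existsNP[i /negP]] := pselect (forall i, s i <= t i); first by left.
rewrite -ltnNge => ti; right=> j.
have := ltn_ord (s i); have := ltn_ord (t j).
by case/orP: (leq_total i j) => ij; have := dmono s ij; have := dmono t ij; lia.
Qed.

(** The square whose triangle [t >= s] is [sa] and whose triangle [t <= s] is
    [sb]; every simplex of [simplex 1 x simplex 1] lies in one of them. *)
Definition square_fun m (p : sprod (simplex 1) (simplex 1) m) : A m :=
  if `[< forall i, p.2 i <= p.1 i >] then act (dadd p.1 p.2) sa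
  else act (dadd p.1 p.2) sb.

Lemma square_fun_ge m (t s : dmap m 1) : (forall i, s i <= t i) ->
  square_fun ((t, s) : sprod (simplex 1) (simplex 1) m) = act (dadd t s) sa.
Proof. by move=> h; rewrite /square_fun; case: asboolP. Qed.

Lemma square_fun_le m (t s : dmap m 1) : (forall i, t i <= s i) ->
  square_fun ((t, s) : sprod (simplex 1) (simplex 1) m) = act (dadd t s) sb.
Proof.
move=> h; rewrite /square_fun; case: asboolP => //= h'.
(* Here t = s: the simplex lies on the diagonal, where t + s = 2t skips the vertex 1, and only the
   common edge of [sa] and [sb] is involved. *)
have -> : dadd t s = dcomp (dface o31) t.
  apply: dmapP => i /=; have := h i; have := h' i; have := ltn_ord (t i).
  rewrite /bump /=; lia.
by rewrite !actM sab.
Qed.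

Program Definition square : smap (sprod (simplex 1) (simplex 1)) A :=
  @SMap _ _ square_fun _.
Next Obligation.
move=> m l r [t s].
have E : dadd (dcomp t r) (dcomp s r) = dcomp (dadd t s) r by exact: dmapP.
have [h|h] := dmap1_total s t.
  by rewrite (square_fun_ge h) -actM -E; apply: square_fun_ge => i /=; exact: h.
by rewrite (square_fun_le h) -actM -E; apply: square_fun_le => i /=; exact: h.
Qed.

End Square.

(** * Lifting horns and edges to the comma *)

Section Comma.
Variables (A B C : sset) (f : smap B A) (g : smap C A).
Let W := comma_sset f g.
Let p0 := comma_p0 f g.
Let p1 := comma_p1 f g.

Definition comma_square n (w : W n) : smap (sprod (simplex 1) (simplex n)) A :=
  (sval w).2.

Lemma comma_square_src n (w : W n) m (s : dmap m n) :
  comma_square w m (dconst m ord0, s) = f m (act s (p0 n w)).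
Proof.
case: w => [[[c b] F] e]; have /= e0 := congr1 snd e; rewrite /= snat e0 -snat.
by congr sfun; congr pair; exact: dmap_eq.
Qed.

Lemma comma_square_tgt n (w : W n) m (s : dmap m n) :
  comma_square w m (dconst m ord_max, s) = g m (act s (p1 n w)).
Proof.
case: w => [[[c b] F] e]; have /= e0 := congr1 fst e; rewrite /= snat e0 -snat.
by congr sfun; congr pair; exact: dmap_eq.
Qed.

Lemma comma_square_act n m (w : W n) (t : dmap m n) l x (s : dmap l m) :
  comma_square (act t w) l (x, s) = comma_square w l (x, dcomp t s).
Proof. by []. Qed.

Lemma comma_eq n (w w' : W n) : p0 n w = p0 n w' -> p1 n w = p1 n w' ->
  (forall m x, comma_square w m x = comma_square w' m x) -> w = w'.
Proof.
case: w w' => [[[c b] F] e] [[[c' b'] F'] e'] /= eb ec eF.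
apply: eq_exist; congr pair; last exact: smap_eq.
by congr pair; [exact: ec|exact: eb].
Qed.

Definition comma_mk n (b : B n) (c : C n) (F : smap (sprod (simplex 1) (simplex n)) A)
    (h0 : F n (dconst n ord0, did n) = f n b)
    (h1 : F n (dconst n ord_max, did n) = g n c) : W n :=
  exist _ ((c, b), F) (esym (f_equal2 pair h1 h0)).

(** Transposed, the data are a map on [simplex 1] times the horn ([G1]) and on the two ends of
    [simplex 1] times [simplex n] ([G2] and [G3]); [hb] and [hc] give agreement on the overlap.
    [box_extension] applies with [S] the boundary of [simplex 1]. *)
Lemma comma_inner_fibration (hA : quasi_category A) n (k : 'I_n.+1) (b : B n) (c : C n) :
  0 < k < n -> forall h : smap (horn k) W,
  (forall m (r : horn k m), p0 m (h m r) = act (sval r) b) ->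
  (forall m (r : horn k m), p1 m (h m r) = act (sval r) c) ->
  exists w : W n, [/\ p0 n w = b, p1 n w = c
    & forall m (r : horn k m), act (sval r) w = h m r].
Proof.
move=> hk h hb hc.
pose S m (x : simplex 1 m) := x = dconst m ord0 \/ x = dconst m ord_max.
pose G1 m (x : simplex 1 m) (s : dmap m n) (a : A m) : Prop :=
  exists H : horn_pred k s, a = comma_square (h m (exist _ s H)) m (x, did m).
pose G2 m (x : simplex 1 m) (s : dmap m n) (a : A m) : Prop :=
  x = dconst m ord0 /\ a = f m (act s b).
pose G3 m (x : simplex 1 m) (s : dmap m n) (a : A m) : Prop :=
  x = dconst m ord_max /\ a = g m (act s c).
pose G0 m x s a := [\/ G1 m x s a, G2 m x s a | G3 m x s a].
have G12 m x s a a' : G1 m x s a -> G2 m x s a' -> a = a'.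
  by move=> [H ->] [-> ->]; rewrite comma_square_src act1 hb.
have G13 m x s a a' : G1 m x s a -> G3 m x s a' -> a = a'.
  by move=> [H ->] [-> ->]; rewrite comma_square_tgt act1 hc.
have G23 m x s a a' : G2 m x s a -> G3 m x s a' -> a = a'.
  by move=> [-> _] [/(congr1 (fun t : dmap m 1 => val (t ord0)))].
have [] := @box_extension A (simplex 1) hA S _ n k hk G0.
- by move=> m l t x [] ->; [left|right]; exact: dmap_eq.
- move=> m x s; split=> [[[xE|xE]|H]|[a [[H _]|[xE _]|[xE _]]]].
  + by exists (f m (act s b)); constructor 2.
  + by exists (g m (act s c)); constructor 3.
  + by exists (comma_square (h m (exist _ s H)) m (x, did m)); constructor 1; exists H.
  + by right.
  + by left; left.
  + by left; right.
- move=> m x s a a' [h1|h1|h1] [h2|h2|h2].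
  + by case: h1 h2 => [H ->] [H' ->]; rewrite (Prop_irrelevance H H').
  + exact: G12 h1 h2.
  + exact: G13 h1 h2.
  + exact/esym/(G12 _ _ _ _ _ h2 h1).
  + by case: h1 h2 => [_ ->] [].
  + exact: G23 h1 h2.
  + exact/esym/(G13 _ _ _ _ _ h2 h1).
  + exact/esym/(G23 _ _ _ _ _ h2 h1).
  + by case: h1 h2 => [_ ->] [].
- move=> m l t x s a [[H ->]|[-> ->]|[-> ->]].
  + constructor 1; pose r : horn k l := exist _ s H.
    exists (proj2_sig (act t r)).
    transitivity (comma_square (h m (act t r)) m (dcomp x t, did m)) => //.
    rewrite (snat h) comma_square_act -snat.
    by congr sfun; congr pair; exact: dmap_eq.
  + by constructor 2; split; [exact: (@dmap_eq m 1)|rewrite -snat -actM].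
  + by constructor 3; split; [exact: (@dmap_eq m 1)|rewrite -snat -actM].
move=> F FP.
have F0 : F n (dconst n ord0, did n) = f n b.
  by apply: FP; constructor 2; split=> //; rewrite act1.
have F1 : F n (dconst n ord_max, did n) = g n c.
  by apply: FP; constructor 3; split=> //; rewrite act1.
exists (comma_mk F0 F1); split=> // m r; apply: comma_eq.
- by rewrite hb.
- by rewrite hc.
- move=> l [x u].
  rewrite comma_square_act; apply: FP; constructor 1.
  exists (proj2_sig (act u r)).
  transitivity (comma_square (h l (act u r)) l (x, did l)) => //.
  by rewrite (snat h) comma_square_act; congr sfun; congr pair; exact: dmap_eq.
Qed.

Lemma comma_quasi_category : quasi_category A -> quasi_category B -> quasi_category C ->
  quasi_category W.
Proof.
move=> hA hB hC; apply: quasi_category_fill => n k hk h.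
have [b hb] := horn_fill hB hk (scomp p0 h).
have [c hc] := horn_fill hC hk (scomp p1 h).
have [|//|w [_ _ hw]] := @comma_inner_fibration hA n k b c hk h; last by exists w.
by move=> m r; rewrite hb.
Qed.

Program Definition comma_aedge (w : W 0) : @edge A (f 0 (p0 0 w)) (g 0 (p1 0 w)) :=
  @Edge A _ _ (comma_square w 1 (did 1, dconst 1 ord0)) _ _.
Next Obligation.
move=> w; rewrite -snat -[in RHS](act1 (p0 0 w)) -comma_square_src.
by congr sfun; congr pair; apply: dmapP; case=> -[].
Qed.
Next Obligation.
move=> w; rewrite -snat -[in RHS](act1 (p1 0 w)) -comma_square_tgt.
by congr sfun; congr pair; apply: dmapP; case=> -[].
Qed.

Lemma comma_vertex_eq (w w' : W 0) : p0 0 w = p0 0 w' -> p1 0 w = p1 0 w' ->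
  edge_cell (comma_aedge w) = comma_aedge w' -> w = w'.
Proof.
move=> e0 e1 ea; apply: comma_eq => // m [t s].
have E (v : W 0) : comma_square v m (t, s) = act t (edge_cell (comma_aedge v)).
  by rewrite /= -snat; congr sfun; congr pair; [exact: dmap_eq|exact: dmap0].
by rewrite !E ea.
Qed.

Lemma comma_edge_of_square (w w' : W 0) (u : edge (p0 0 w) (p0 0 w'))
    (v : edge (p1 0 w) (p1 0 w')) (d : edge (f 0 (p0 0 w)) (g 0 (p1 0 w'))) :
  triangle (comma_aedge w) (edge_map g v) d ->
  triangle (edge_map f u) (comma_aedge w') d ->
  exists E : edge w w', p0 1 E = u /\ p1 1 E = v.
Proof.
move=> [sa [sa2 sa0 sa1]] [sb [sb2 sb0 sb1]].
have sab : act (@dface 1 o31) sa = act (@dface 1 o31) sb by rewrite sa1 sb1.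
have F0 : square sab 1 (dconst 1 ord0, did 1) = f 1 u.
  rewrite -[RHS]sb2 [LHS](square_fun_le sab) //.
  by congr act; apply: dmapP; case=> -[|[]].
have F1 : square sab 1 (dconst 1 ord_max, did 1) = g 1 v.
  rewrite -[RHS]sa0 [LHS](square_fun_ge sa sb); last by case=> -[|[]].
  by congr act; apply: dmapP; case=> -[|[]].
have src : act (@dface 0 ord_max) (comma_mk F0 F1) = w.
  apply: comma_vertex_eq; [exact: (edge_src u)|exact: (edge_src v)|].
  rewrite -[RHS]sa2 [LHS](square_fun_ge sa sb); last by case=> -[|[]].
  by congr act; apply: dmapP; case=> -[|[]].
have tgt : act (@dface 0 ord0) (comma_mk F0 F1) = w'.
  apply: comma_vertex_eq; [exact: (edge_tgt u)|exact: (edge_tgt v)|].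
  rewrite -[RHS]sb0 [LHS](square_fun_le sab); last by case=> -[|[]].
  by congr act; apply: dmapP; case=> -[|[]].
by exists (Edge src tgt).
Qed.

(** Equality of the two composites in [ho A] is a homotopy between chosen composites, so both halves
    of the square can be given the same diagonal [d]. *)
Lemma comma_edge_full (hA : quasi_category A) (w w' : W 0) (u : edge (p0 0 w) (p0 0 w'))
    (v : edge (p1 0 w) (p1 0 w')) :
  ho_edge (edge_map g v) \oc ho_edge (comma_aedge w)
    = ho_edge (comma_aedge w') \oc ho_edge (edge_map f u) ->
  exists E : edge w w', p0 1 E = u /\ p1 1 E = v.
Proof.
have [d td] := triangle_fill hA (comma_aedge w) (edge_map g v).
have [d' td'] := triangle_fill hA (edge_map f u) (comma_aedge w').
rewrite (ho_triangle td) (ho_triangle td') => dd'.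
apply: comma_edge_of_square td _.
by apply/(triangle_uniq hA _ td'); apply/(ho_edge_homotopic hA).
Qed.

End Comma.

Lemma iso_of_inverses (C : category) (x y : C) (u : chom x y) (v w : chom y x) :
  v \oc u = cid x -> u \oc w = cid y -> is_iso u.
Proof.
move=> vu uw; exists v; split=> //.
have -> : v = w by rewrite -[LHS]ccomp1r -uw ccompA vu ccomp1l.
exact: uw.
Qed.

Lemma iso_of_left_inverses (C : category) (x y : C) (u w : chom x y) (v : chom y x) :
  v \oc u = cid x -> w \oc v = cid y -> is_iso u.
Proof.
move=> vu wv; exists v; split=> //.
have -> : u = w by rewrite -[LHS]ccomp1l -wv -ccompA vu ccomp1r.
exact: wv.
Qed.

Lemma iso_of_iso_comp (C : category) (x y : C) (u : chom x y) (v : chom y x) :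
  is_iso (v \oc u) -> is_iso (u \oc v) -> is_iso u.
Proof.
move=> [a [a1 _]] [b [_ b1]].
by apply: (@iso_of_inverses _ _ _ u (a \oc v) (v \oc b)); rewrite -?ccompA // ccompA.
Qed.

Lemma iso_comp (C : category) (x y z : C) (v : chom y z) (u : chom x y) :
  is_iso v -> is_iso u -> is_iso (v \oc u).
Proof.
move=> [b [b1 b2]] [a [a1 a2]]; exists (a \oc b).
split.
  by rewrite -ccompA (ccompA b) b1 ccomp1l.
by rewrite -ccompA (ccompA u) a2 ccomp1l.
Qed.

(** [dcone1 t s] collapses the end [t = 0] of [simplex 1 x simplex n] to the
    first vertex; [dcone2 t s] collapses the end [t = 1] to the last one. *)
Program Definition dcone1 m n (t : dmap m 1) (s : dmap m n) : dmap m n.+1 :=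
  @DMap m n.+1 (fun i => @Ordinal n.+2 (t i * (s i).+1) _) _.
Next Obligation.
by move=> m n t s i; have := ltn_ord (t i); have := ltn_ord (s i); nia.
Qed.
Next Obligation. by move=> m n t s i j ij; rewrite /= leq_mul ?ltnS ?dmono. Qed.

Program Definition dcone2 m n (t : dmap m 1) (s : dmap m n) : dmap m n.+1 :=
  @DMap m n.+1 (fun i => @Ordinal n.+2 (maxn (s i) (t i * n.+1)) _) _.
Next Obligation.
by move=> m n t s i; have := ltn_ord (t i); have := ltn_ord (s i); nia.
Qed.
Next Obligation.
move=> m n t s i j ij /=; have := dmono s ij.
have : t i * n.+1 <= t j * n.+1 by rewrite leq_mul2r dmono ?orbT.
by lia.
Qed.

(** * Invertible edges of the comma *)

Section CommaHomotopy.
Variables (A B C : sset) (f : smap B A) (g : smap C A).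
Let W := comma_sset f g.
Let p0 := comma_p0 f g.
Let p1 := comma_p1 f g.

Lemma comma_edge_comm (w w' : W 0) (E : edge w w') :
  ho_edge (edge_map g (edge_map p1 E)) \oc ho_edge (comma_aedge w)
    = ho_edge (comma_aedge w') \oc ho_edge (edge_map f (edge_map p0 E)).
Proof.
pose F := comma_square (edge_cell E).
(* In coordinates (t, s), [sa] runs through (0,0), (1,0), (1,1) and [sb] through (0,0), (0,1),
   (1,1): the halves of the square, with a common diagonal. *)
pose sa := F 2 (ddeg (leqnn 1), ddeg (leq0n 1)).
pose sb := F 2 (ddeg (leq0n 1), ddeg (leqnn 1)).
have sa2 : act (@dface 1 ord_max) sa = comma_aedge w.
  rewrite /sa -snat /= -[in RHS](edge_src E) comma_square_act.
  by congr (sfun F); congr pair; apply: dmapP; case=> -[|[]].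
have sa0 : act (@dface 1 ord0) sa = edge_map g (edge_map p1 E).
  rewrite /sa -snat /= -[edge_cell E in RHS]act1 -comma_square_tgt.
  by congr (sfun F); congr pair; apply: dmapP; case=> -[|[]].
have sb2 : act (@dface 1 ord_max) sb = edge_map f (edge_map p0 E).
  rewrite /sb -snat /= -[edge_cell E in RHS]act1 -comma_square_src.
  by congr (sfun F); congr pair; apply: dmapP; case=> -[|[]].
have sb0 : act (@dface 1 ord0) sb = comma_aedge w'.
  rewrite /sb -snat /= -[in RHS](edge_tgt E) comma_square_act.
  by congr (sfun F); congr pair; apply: dmapP; case=> -[|[]].
have [d td de] := triangle_of_cell sa2 sa0.
rewrite (ho_triangle td); apply/esym/ho_triangle; exists sb; split=> //.
rewrite -de /sa /sb -!snat.
by congr (sfun F); congr pair; apply: dmapP; case=> -[|[]].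
Qed.

Section Cones.
Variables (b : B 0) (c : C 0).

(** Then [r] has first vertex f b and opposite face constant at g c: it is a simplex of the
    left-pinched morphism space of A from f b to g c, seen in the fibre of f|g over (b, c). In
    [right_cone] it is the last vertex that is g c, and the opposite face is constant at f b. *)
Definition left_cone n (w : W n) (r : A n.+1) : Prop :=
  [/\ p0 n w = act (dconst n ord0) b, p1 n w = act (dconst n ord0) c
    & forall m t s, comma_square w m (t, s) = act (dcone1 t s) r].

Definition right_cone n (w : W n) (r : A n.+1) : Prop :=
  [/\ p0 n w = act (dconst n ord0) b, p1 n w = act (dconst n ord0) c
    & forall m t s, comma_square w m (t, s) = act (dcone2 t s) r].

Lemma left_cone_exists n (r : A n.+1) :
  act (dconst 0 ord0) r = f 0 b -> act (dface ord0) r = g n (act (dconst n ord0) c) ->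
  exists w : W n, left_cone w r.
Proof.
move=> r0 r1.
have Fnat m l (t : dmap m l) (p : sprod (simplex 1) (simplex n) l) :
    act (dcone1 (dcomp p.1 t) (dcomp p.2 t)) r = act t (act (dcone1 p.1 p.2) r).
  by rewrite -actM; congr act; exact: dmapP.
pose F : smap (sprod (simplex 1) (simplex n)) A :=
  @SMap (sprod (simplex 1) (simplex n)) A (fun m p => act (dcone1 p.1 p.2) r) Fnat.
have F0 : F n (dconst n ord0, did n) = f n (act (dconst n ord0) b).
  by rewrite snat -r0 -actM /=; congr act; exact: dmapP.
have F1 : F n (dconst n ord_max, did n) = g n (act (dconst n ord0) c).
  rewrite -r1 /=; congr act; apply: dmapP => i /=; rewrite /bump /=; lia.
by exists (comma_mk F0 F1).
Qed.

Lemma right_cone_exists n (r : A n.+1) :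
  act (dconst 0 ord_max) r = g 0 c ->
  act (dface ord_max) r = f n (act (dconst n ord0) b) ->
  exists w : W n, right_cone w r.
Proof.
move=> r1 r0.
have Fnat m l (t : dmap m l) (p : sprod (simplex 1) (simplex n) l) :
    act (dcone2 (dcomp p.1 t) (dcomp p.2 t)) r = act t (act (dcone2 p.1 p.2) r).
  by rewrite -actM; congr act; exact: dmapP.
pose F : smap (sprod (simplex 1) (simplex n)) A :=
  @SMap (sprod (simplex 1) (simplex n)) A (fun m p => act (dcone2 p.1 p.2) r) Fnat.
have F0 : F n (dconst n ord0, did n) = f n (act (dconst n ord0) b).
  rewrite -r0 /=; congr act; apply: dmapP => i /=; rewrite /bump /=.
  have := ltn_ord i; lia.
have F1 : F n (dconst n ord_max, did n) = g n (act (dconst n ord0) c).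
  rewrite snat -r1 -actM /=; congr act; apply: dmapP => i /=.
  have := ltn_ord i; lia.
by exists (comma_mk F0 F1).
Qed.

Lemma left_cone_uniq n (w w' : W n) r : left_cone w r -> left_cone w' r -> w = w'.
Proof.
move=> [h0 h1 h] [h0' h1' h']; apply: comma_eq; rewrite ?h0 ?h1 //.
by move=> m [t s]; rewrite h h'.
Qed.

Lemma right_cone_uniq n (w w' : W n) r : right_cone w r -> right_cone w' r -> w = w'.
Proof.
move=> [h0 h1 h] [h0' h1' h']; apply: comma_eq; rewrite ?h0 ?h1 //.
by move=> m [t s]; rewrite h h'.
Qed.

(** [t'] is the join of a point with [t]: a first vertex is adjoined and preserved. *)
Lemma left_cone_act n l (t : dmap n l) (t' : dmap n.+1 l.+1) (w : W l) r :
  t' ord0 = 0 :> nat -> (forall i, t' (lift ord0 i) = (t i).+1 :> nat) ->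
  left_cone w r -> left_cone (act t w) (act t' r).
Proof.
move=> t0 tS [h0 h1 h]; split.
- by rewrite snat h0 -actM; congr act; exact: dmap0.
- by rewrite snat h1 -actM; congr act; exact: dmap0.
move=> m x s; rewrite comma_square_act h -actM; congr act; apply: dmapP => i.
have [E|E] : x i = 0 :> nat \/ x i = 1 :> nat by have := ltn_ord (x i); lia.
  transitivity (nat_of_ord (t' ord0)); first by rewrite t0 /= E.
  by congr (nat_of_ord (t' _)); apply/val_inj; rewrite /= E.
transitivity (nat_of_ord (t' (lift ord0 (s i)))); first by rewrite tS /= E mul1n.
by congr (nat_of_ord (t' _)); apply/val_inj; rewrite /= E mul1n.
Qed.

Lemma right_cone_act n l (t : dmap n l) (t' : dmap n.+1 l.+1) (w : W l) r :
  t' ord_max = l.+1 :> nat -> (forall i, t' (lift ord_max i) = t i :> nat) ->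
  right_cone w r -> right_cone (act t w) (act t' r).
Proof.
move=> t0 tS [h0 h1 h]; split.
- by rewrite snat h0 -actM; congr act; exact: dmap0.
- by rewrite snat h1 -actM; congr act; exact: dmap0.
move=> m x s; rewrite comma_square_act h -actM; congr act; apply: dmapP => i.
have := ltn_ord (s i); have := ltn_ord (t (s i)).
have [E|E] : x i = 0 :> nat \/ x i = 1 :> nat by have := ltn_ord (x i); lia.
  move=> ti si; transitivity (nat_of_ord (t' (lift ord_max (s i)))).
    by rewrite tS /= E; lia.
  by congr (nat_of_ord (t' _)); apply/val_inj; rewrite /= E /bump; lia.
move=> ti si; transitivity (nat_of_ord (t' ord_max)).
  by rewrite t0 /= E; lia.
by congr (nat_of_ord (t' _)); apply/val_inj; rewrite /= E; lia.
Qed.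

Lemma left_cone_vertex n (w : W n) r : left_cone w r -> act (dconst 0 ord0) r = f 0 b.
Proof.
move=> [h0 _ h]; rewrite -[b]act1.
rewrite (_ : did 0 = dcomp (dconst n ord0) (dconst 0 ord0)); last exact: dmap0.
rewrite actM -h0 -comma_square_src h; congr act; exact: dmapP.
Qed.

Lemma left_cone_face n (w : W n) r : left_cone w r ->
  act (dface ord0) r = g n (act (dconst n ord0) c).
Proof.
move=> [_ h1 h]; rewrite -h1 -[p1 n w]act1 -comma_square_tgt h; congr act.
by apply: dmapP => i /=; rewrite /bump /=; lia.
Qed.

Lemma right_cone_vertex n (w : W n) r :
  right_cone w r -> act (dconst 0 ord_max) r = g 0 c.
Proof.
move=> [_ h1 h]; rewrite -[c]act1.
rewrite (_ : did 0 = dcomp (dconst n ord0) (dconst 0 ord0)); last exact: dmap0.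
rewrite actM -h1 -comma_square_tgt h; congr act; apply: dmapP => i /=; lia.
Qed.

Lemma right_cone_face n (w : W n) r : right_cone w r ->
  act (dface ord_max) r = f n (act (dconst n ord0) b).
Proof.
move=> [h0 _ h]; rewrite -h0 -[p0 n w]act1 -comma_square_src h; congr act.
by apply: dmapP => i /=; rewrite /bump /=; have := ltn_ord i; lia.
Qed.

(** Vertex i of the triangle [z] is the edge of [r] from 0 to i+1. Face 3 of [r] is the given [s],
    face 2 is degenerate on the arrow of [w], face 0 is constant, and face 1 of the filler gives the
    left inverse. This is again a left cone, so that [left_cone_iso] can apply the construction
    twice. *)
Lemma left_cone_inverse (hA : quasi_category A) (w w' : W 0) (E : edge w w') s :
  left_cone E s -> exists (E' : edge w' w) s',
    left_cone E' s' /\ triangle E E' (edge_refl w).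
Proof.
move=> hE.
pose gc : A 2 := act (dconst 2 ord0) (g 0 c).
pose e := act (@dface 1 ord_max) s.
have s0 : act (@dface 1 ord0) s = act (dconst 1 ord0) (g 0 c).
  by rewrite (left_cone_face hE) snat.
have [|||r [r0 r2 r3]] := horn31_fill hA (d0 := gc)
  (d2 := act (ddeg (leqnn 1)) e) (d3 := s).
- rewrite /gc /e -!actM.
  have -> : dcomp (dface ord_max) (dcomp (ddeg (leqnn 1)) (dface ord0)) =
      dcomp (@dface 1 ord0) (dconst 1 ord0) by apply: dmapP; case=> -[|[]].
  by rewrite [RHS]actM s0 -actM; congr act; exact: dmap0.
- by rewrite s0 -actM; congr act; exact: dmap0.
- by rewrite -[RHS]act1 /e -actM; congr act; apply: dmapP; case=> -[|[]].
have [||z hz] := @left_cone_exists 2 r.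
- by rewrite -(left_cone_vertex hE) -r3 -actM; congr act; apply: dmapP; case=> -[].
- by rewrite r0 snat.
have zE : act (@dface 1 ord_max) z = E.
  apply: left_cone_uniq hE; rewrite -r3; apply: left_cone_act hz => //.
  by case=> -[|[]].
have hw : left_cone w e.
  rewrite -(edge_src E); apply: left_cone_act hE => //.
  by case=> -[].
have zd : act (@dface 1 o31) z = degen w.
  apply: (@left_cone_uniq _ _ _ (act (ddeg (leqnn 1)) e)).
    rewrite -r2; apply: left_cone_act hz => //; by case=> -[|[]].
  apply: left_cone_act hw => //; by case=> -[|[]].
have src : act (@dface 0 ord_max) (act (@dface 1 ord0) z) = w'.
  by rewrite -(edge_tgt E) -zE; apply: act_dmapP; case=> -[].
have tgt : act (@dface 0 ord0) (act (@dface 1 ord0) z) = w.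
  transitivity (act (@dface 0 ord0) (act (@dface 1 o31) z)).
    by apply: act_dmapP; case=> -[].
  by rewrite zd; exact: (edge_tgt (edge_refl w)).
exists (Edge src tgt), (act (@dface 2 o41) r); split; last by exists z.
by apply: left_cone_act hz => //; case=> -[|[]].
Qed.

(** Dually, vertex i of [z] is the edge of [r] from i to 3, and the horn at 2 gives a right
    inverse. *)
Lemma right_cone_inverse (hA : quasi_category A) (w w' : W 0) (E : edge w w') s :
  right_cone E s -> exists (E' : edge w' w) s',
    right_cone E' s' /\ triangle E' E (edge_refl w').
Proof.
move=> hE.
pose fb : A 2 := act (dconst 2 ord0) (f 0 b).
pose e := act (@dface 1 ord0) s.
have s2 : act (@dface 1 ord_max) s = act (dconst 1 ord0) (f 0 b).
  by rewrite (right_cone_face hE) snat.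
have [|||r [r0 r1 r3]] := horn32_fill hA (d0 := s)
  (d1 := act (ddeg (leq0n 1)) e) (d3 := fb).
- by rewrite /e -!actM; congr act; apply: dmapP; case=> -[|[]].
- by rewrite s2 -actM; congr act; exact: dmap0.
- rewrite /fb /e -!actM.
  have -> : dcomp (dface ord0) (dcomp (ddeg (leq0n 1)) (dface ord_max)) =
      dcomp (@dface 1 ord_max) (dconst 1 ord_max) by apply: dmapP; case=> -[|[]].
  by rewrite [LHS]actM s2 -actM; congr act; exact: dmap0.
have [||z hz] := @right_cone_exists 2 r.
- by rewrite -(right_cone_vertex hE) -r0 -actM; congr act; apply: dmapP; case=> -[].
- by rewrite r3 snat.
have zE : act (@dface 1 ord0) z = E.
  apply: right_cone_uniq hE; rewrite -r0; apply: right_cone_act hz => //.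
  by case=> -[|[]].
have hw : right_cone w' e.
  rewrite -(edge_tgt E); apply: right_cone_act hE => //.
  by case=> -[].
have zd : act (@dface 1 o31) z = degen w'.
  apply: (@right_cone_uniq _ _ _ (act (ddeg (leq0n 1)) e)).
    rewrite -r1; apply: right_cone_act hz => //; by case=> -[|[]].
  apply: right_cone_act hw => //; by case=> -[|[]].
have src : act (@dface 0 ord_max) (act (@dface 1 ord_max) z) = w'.
  transitivity (act (@dface 0 ord_max) (act (@dface 1 o31) z)).
    by apply: act_dmapP; case=> -[].
  by rewrite zd; exact: (edge_src (edge_refl w')).
have tgt : act (@dface 0 ord0) (act (@dface 1 ord_max) z) = w.
  by rewrite -(edge_src E) -zE; apply: act_dmapP; case=> -[].
exists (Edge src tgt), (act (@dface 2 o42) r); split; last by exists z.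
by apply: right_cone_act hz => //; case=> -[|[]].
Qed.

Lemma left_cone_iso (hA : quasi_category A) (w w' : W 0) (E : edge w w') s :
  left_cone E s -> is_iso (ho_edge E).
Proof.
move=> /(left_cone_inverse hA)[E' [s' [/(left_cone_inverse hA)[E'' [_ [_ t']]] t]]].
have iE := ho_triangle t; have iE' := ho_triangle t'.
rewrite !(ho_edge_degen (e := edge_refl _)) // in iE iE'.
exact: iso_of_left_inverses iE iE'.
Qed.

Lemma right_cone_iso (hA : quasi_category A) (w w' : W 0) (E : edge w w') s :
  right_cone E s -> is_iso (ho_edge E).
Proof.
move=> /(right_cone_inverse hA)[E' [s' [/(right_cone_inverse hA)[E'' [_ [_ t']]] t]]].
have iE := ho_triangle t; have iE' := ho_triangle t'.
rewrite !(ho_edge_degen (e := edge_refl _)) // in iE iE'.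
have e : ho_edge E = ho_edge E'' by rewrite -[LHS]ccomp1r -iE' ccompA iE ccomp1l.
by exists (ho_edge E'); split; rewrite ?iE // e.
Qed.

End Cones.

(** For t = 0 this sends the vertices s = 0, 1, 2 to 0, 0, 1, and for t = 1 to 0, 1, 1; over the
    middle vertex it traces the diagonal of the square. *)
Program Definition dstep m (t : dmap m 1) (s : dmap m 2) : dmap m 1 :=
  @DMap m 1 (fun i => @Ordinal 2 (minn (s i - (1 - t i)) 1) _) _.
Next Obligation. by move=> m t s i; rewrite ltnS geq_minr. Qed.
Next Obligation.
by move=> m t s i j ij /=; have := dmono s ij; have := dmono t ij; lia.
Qed.

(** A square with degenerate horizontal sides factors, along its diagonal,
    into a left cone followed by a right cone. *)
Lemma comma_vertical_iso (hA : quasi_category A) (b : B 0) (c : C 0) (w w' : W 0)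
    (E : edge w w') :
  p0 1 E = act (dconst 1 ord0) b -> p1 1 E = act (dconst 1 ord0) c ->
  is_iso (ho_edge E).
Proof.
move=> E0 E1.
pose F := comma_square (edge_cell E).
have Fnat m l (r : dmap m l) (p : sprod (simplex 1) (simplex 2) l) :
    F m (dcomp p.1 r, dstep (dcomp p.1 r) (dcomp p.2 r))
    = act r (F l (p.1, dstep p.1 p.2)).
  by rewrite -snat; congr (sfun F); congr pair; exact: dmapP.
pose G : smap (sprod (simplex 1) (simplex 2)) A :=
  @SMap (sprod (simplex 1) (simplex 2)) A (fun m p => F m (p.1, dstep p.1 p.2)) Fnat.
have G0 : G 2 (dconst 2 ord0, did 2) = f 2 (act (dconst 2 ord0) b).
  by rewrite [LHS]comma_square_src E0 -actM; congr (f _ (act _ _)); exact: dmap0.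
have G1 : G 2 (dconst 2 ord_max, did 2) = g 2 (act (dconst 2 ord0) c).
  by rewrite [LHS]comma_square_tgt E1 -actM; congr (g _ (act _ _)); exact: dmap0.
pose z := comma_mk G0 G1.
have zE : act (@dface 1 o31) z = E.
  apply: comma_eq.
  - by rewrite E0 -[LHS]actM; congr act; exact: dmap0.
  - by rewrite E1 -[LHS]actM; congr act; exact: dmap0.
  move=> m [t s]; rewrite comma_square_act; congr (sfun F); congr pair.
  apply: dmapP => i /=; rewrite /bump /=.
  by have := ltn_ord (s i); have := ltn_ord (t i); lia.
have z1 : left_cone b c (act (@dface 1 ord_max) z)
    (F 2 (ddeg (leqnn 1), ddeg (leq0n 1))).
  split.
  - by rewrite -[LHS]actM; congr act; exact: dmap0.
  - by rewrite -[LHS]actM; congr act; exact: dmap0.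
  move=> m t s; rewrite comma_square_act -snat; congr (sfun F).
  congr pair; apply: dmapP => i /=; rewrite /bump /unbump /=.
    by have := ltn_ord (s i); have := ltn_ord (t i); nia.
  by have := ltn_ord (s i); have := ltn_ord (t i); nia.
have z2 : right_cone b c (act (@dface 1 ord0) z)
    (F 2 (ddeg (leq0n 1), ddeg (leqnn 1))).
  split.
  - by rewrite -[LHS]actM; congr act; exact: dmap0.
  - by rewrite -[LHS]actM; congr act; exact: dmap0.
  move=> m t s; rewrite comma_square_act -snat; congr (sfun F).
  congr pair; apply: dmapP => i /=; rewrite /bump /unbump /=.
    by have := ltn_ord (s i); have := ltn_ord (t i); nia.
  by have := ltn_ord (s i); have := ltn_ord (t i); nia.
pose x := act (@dface 0 ord0) (act (@dface 1 ord_max) z).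
have src1 : act (@dface 0 ord_max) (act (@dface 1 ord_max) z) = w.
  by rewrite -(edge_src E) -zE; apply: act_dmapP; case=> -[].
have src2 : act (@dface 0 ord_max) (act (@dface 1 ord0) z) = x.
  by apply: act_dmapP; case=> -[].
have tgt2 : act (@dface 0 ord0) (act (@dface 1 ord0) z) = w'.
  by rewrite -(edge_tgt E) -zE; apply: act_dmapP; case=> -[].
pose e1 := Edge src1 (erefl x); pose e2 := Edge src2 tgt2.
have <- : ho_edge e2 \oc ho_edge e1 = ho_edge E by apply: ho_triangle; exists z.
apply: iso_comp; first exact: (right_cone_iso (E := e2) hA z2).
exact: (left_cone_iso (E := e1) hA z1).
Qed.

(** Identities in [ho B] and [ho C] only mean homotopies [tb] and [tc] from the projections to
    degenerate edges. Lifting these from the horn with faces [E] and the degenerate edge of [w]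
    replaces [E] by a homotopic edge whose projections are strictly degenerate. *)
Lemma comma_endo_iso (hA : quasi_category A) (hB : quasi_category B)
    (hC : quasi_category C) (w : W 0) (E : edge w w) :
  ho_edge (edge_map p0 E) = cid _ -> ho_edge (edge_map p1 E) = cid _ ->
  is_iso (ho_edge E).
Proof.
rewrite -(ho_edge_degen (e := edge_refl (p0 0 w))) //.
move=> /(ho_edge_homotopic hB)[tb [tb2 tb0 tb1]].
rewrite -(ho_edge_degen (e := edge_refl (p1 0 w))) //.
move=> /(ho_edge_homotopic hC)[tc [tc2 tc0 tc1]].
pose d : 'I_3 -> W 1 := fun i => if val i is 0 then degen w else edge_cell E.
have [|h hP] := @horn_of_faces W 0 o31 d.
  move=> [[|[|[|i]]] hi] [[|[|[|j]]] hj] //;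
  move=> [[|[|i']] hi'] [[|[|j']] hj'] //= _ _ _ _ _.
  rewrite (_ : Ordinal hj' = ord_max); last exact/val_inj.
  rewrite (_ : Ordinal hi' = ord0); last exact/val_inj.
  exact: etrans (edge_src (edge_refl w)) (esym (edge_tgt E)).
have [||y [y0 y1 yh]] := @comma_inner_fibration _ _ _ f g hA 2 o31 tb tc isT h.
- move=> m r; case: (svalP r) => j jk /dface_factor[u ru].
  rewrite (hP _ _ _ _ jk ru) snat ru actM; congr act.
  case: j jk {ru} => [[|[|[|j]]] hj] // _.
    apply: etrans (snat p0 _ _) (etrans (esym tb0) _).
    by congr (act (dface _) tb); exact/val_inj.
  by apply: etrans (esym tb2) _; congr (act (dface _) tb); exact/val_inj.
- move=> m r; case: (svalP r) => j jk /dface_factor[u ru].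
  rewrite (hP _ _ _ _ jk ru) snat ru actM; congr act.
  case: j jk {ru} => [[|[|[|j]]] hj] // _.
    apply: etrans (snat p1 _ _) (etrans (esym tc0) _).
    by congr (act (dface _) tc); exact/val_inj.
  by apply: etrans (esym tc2) _; congr (act (dface _) tc); exact/val_inj.
have face (j : 'I_3) (jk : j != o31) : act (dface j) y = d j.
  pose r : horn o31 1 := exist _ (dface j) (horn_face jk).
  apply: etrans (yh _ r) _.
  by rewrite (hP _ r j (did _) jk) ?act1 //; exact: dmap_eq.
have y2 : act (@dface 1 ord_max) y = E by rewrite face.
have y0' : act (@dface 1 ord0) y = edge_refl w by rewrite face.
have [E' tE' yE'] := triangle_of_cell y2 y0'.
have <- : ho_edge E' = ho_edge E.
  by rewrite -(ho_triangle tE') (ho_edge_degen (e := edge_refl w)) // ccomp1l.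
apply: (comma_vertical_iso hA (b := p0 0 w) (c := p1 0 w)).
- by rewrite -yE' snat y0.
- by rewrite -yE' snat y1.
Qed.

Lemma ho_map_edge (X Y : sset) (u : smap X Y) (x y : X 0) (e : edge x y) :
  fhom (ho_map u) (ho_edge e) = ho_edge (edge_map u e).
Proof. by rewrite /= ho_map_homE. Qed.

Lemma comma_conservative (hA : quasi_category A) (hB : quasi_category B)
    (hC : quasi_category C) (w w' : W 0) (u : @chom (ho W) w w') :
  is_iso (fhom (ho_map p0) u) -> is_iso (fhom (ho_map p1) u) -> is_iso u.
Proof.
have hW := comma_quasi_category (f := f) (g := g) hA hB hC.
have [E uE] := ho_edge_surj hW u; rewrite {u}uE !ho_map_edge.
case=> [b [b1 b2]] [c [c1 c2]].
have [ub bE] := ho_edge_surj hB b; have [vc cE] := ho_edge_surj hC c.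
rewrite {}bE {}cE in b1 b2 c1 c2.
(* The commutation required of the inverse pair follows by composing the equation of
   [comma_edge_comm] with the inverses on both sides. *)
have [|E' [E'0 E'1]] := comma_edge_full hA (w := w') (w' := w) (u := ub) (v := vc).
  have comm := comma_edge_comm E; rewrite -!ho_map_edge in comm *.
  have gv : fhom (ho_map g) (ho_edge vc)
    \oc fhom (ho_map g) (fhom (ho_map p1) (ho_edge E)) = cid _.
    by rewrite -fhomM ho_map_edge c1 fhom1.
  have fu : fhom (ho_map f) (fhom (ho_map p0) (ho_edge E))
    \oc fhom (ho_map f) (ho_edge ub) = cid _.
    by rewrite -fhomM ho_map_edge b2 fhom1.
  rewrite -[LHS]ccomp1r -[in LHS]fu ccompA -(ccompA _ (ho_edge (comma_aedge w'))).
  by rewrite -comm !ccompA gv ccomp1l.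
have e0 : edge_map p0 E' = ub by exact: edge_eq.
have e1 : edge_map p1 E' = vc by exact: edge_eq.
apply: (iso_of_iso_comp (v := ho_edge E')).
- have [D DE] := ho_edge_surj hW (ho_edge E' \oc ho_edge E).
  rewrite DE; apply: comma_endo_iso => //; rewrite -ho_map_edge -DE fhomM !ho_map_edge.
    by rewrite e0.
  by rewrite e1.
- have [D DE] := ho_edge_surj hW (ho_edge E \oc ho_edge E').
  rewrite DE; apply: comma_endo_iso => //; rewrite -ho_map_edge -DE fhomM !ho_map_edge.
    by rewrite e0.
  by rewrite e1.
Qed.

End CommaHomotopy.

(** * Exponentials of comma quasi-categories *)

Lemma is_iso_fhom (C D : category) (F : functor C D) (x y : C) (u : chom x y) :
  is_iso u -> is_iso (fhom F u).
Proof. by case=> v [vu uv]; exists (fhom F v); rewrite -!fhomM vu uv !fhom1. Qed.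

Lemma is_iso_hcast (C : category) (x y x' y' : C) (ex : x = x') (ey : y = y')
  (u : chom x y) : is_iso u -> is_iso (hcast ex ey u).
Proof. by subst; rewrite hcast_id. Qed.

Lemma comma_vertex_of_edge (A B C : sset) (f : smap B A) (g : smap C A)
    (b : B 0) (c : C 0) (e : edge (f 0 b) (g 0 c)) :
  exists w : comma_sset f g 0, [/\ comma_p0 f g 0 w = b, comma_p1 f g 0 w = c
    & edge_cell (comma_aedge w) = e].
Proof.
have Fnat m l (t : dmap m l) (p : sprod (simplex 1) (simplex 0) l) :
  act (dcomp p.1 t) (edge_cell e) = act t (act p.1 (edge_cell e)) by rewrite actM.
pose F : smap (sprod (simplex 1) (simplex 0)) A :=
  @SMap (sprod (simplex 1) (simplex 0)) A (fun m p => act p.1 (edge_cell e)) Fnat.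
have F0 : F 0 (dconst 0 ord0, did 0) = f 0 b.
  by rewrite -[RHS](edge_src e); congr act; apply: dmapP; case=> -[].
have F1 : F 0 (dconst 0 ord_max, did 0) = g 0 c.
  by rewrite -[RHS](edge_tgt e); congr act; apply: dmapP; case=> -[].
by exists (comma_mk F0 F1); split=> //; rewrite -[RHS]act1.
Qed.

Section CommaExponential.
Variables (A B C X : sset) (f : smap B A) (g : smap C A).
Let W := comma_sset f g.
Let WX := comma_sset (sexp_post X f) (sexp_post X g).

Section ToSquare.
Variables (n : nat) (a : sexp X W n).
Let a' : smap (sprod X (simplex n)) W := a.

Program Definition exp_square_cell m (p : sprod (simplex 1) (simplex n) m) :
    sexp X A m :=
  @SMap (sprod X (simplex m)) A (fun l q =>
    comma_square (a' l (q.1, dcomp p.2 q.2)) l (dcomp p.1 q.2, did l)) _.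
Next Obligation.
move=> m p k l t [x r] /=; rewrite -snat /=.
have -> : (act t x, dcomp p.2 (dcomp r t)) =
    act t ((x, dcomp p.2 r) : sprod X (simplex n) l) :> sprod X (simplex n) k.
  by congr pair; exact: dmap_eq.
rewrite (snat a') comma_square_act.
by congr sfun; congr pair; exact: dmap_eq.
Qed.

Program Definition exp_square : smap (sprod (simplex 1) (simplex n)) (sexp X A) :=
  @SMap _ _ exp_square_cell _.
Next Obligation.
move=> m l t p; apply: smap_eq => k [x r] /=.
congr (sfun (comma_square (sfun a' (_, _))) (_, _)); exact: dmap_eq.
Qed.

Lemma exp_square_src :
  exp_square n (dconst n ord0, did n) = sexp_post X f n (scomp (comma_p0 f g) a').
Proof.
apply: smap_eq => l [x r] /=.
rewrite (_ : dcomp (dconst n ord0) r = dconst l ord0); last exact: dmap_eq.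
rewrite comma_square_src act1; congr (f _ (comma_p0 f g _ (a' _ (_, _)))).
exact: dmap_eq.
Qed.

Lemma exp_square_tgt :
  exp_square n (dconst n ord_max, did n) = sexp_post X g n (scomp (comma_p1 f g) a').
Proof.
apply: smap_eq => l [x r] /=.
rewrite (_ : dcomp (dconst n ord_max) r = dconst l ord_max); last exact: dmap_eq.
rewrite comma_square_tgt act1; congr (g _ (comma_p1 f g _ (a' _ (_, _)))).
exact: dmap_eq.
Qed.

Definition exp_to_comma_cell : WX n := comma_mk exp_square_src exp_square_tgt.

End ToSquare.

Program Definition exp_to_comma : smap (sexp X W) WX := @SMap _ _ exp_to_comma_cell _.
Next Obligation.
move=> m n t a; apply: comma_eq; [exact: smap_eq|exact: smap_eq|].
move=> l [r s]; apply: smap_eq => k [x u] /=.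
congr (sfun (comma_square (sfun (a : smap _ W) (_, _))) _); exact: dmap_eq.
Qed.

Section OfSquare.
Variables (n : nat) (w : WX n).
Let b : smap (sprod X (simplex n)) B := comma_p0 _ _ n w.
Let c : smap (sprod X (simplex n)) C := comma_p1 _ _ n w.
Let sq m (t : dmap m 1) (s : dmap m n) : smap (sprod X (simplex m)) A :=
  comma_square w m (t, s).

Lemma sq_act k m (r : dmap k m) t s l (x : X l) (u : dmap l k) :
  sq (dcomp t r) (dcomp s r) l (x, u) = sq t s l (x, dcomp r u).
Proof.
have := snat (comma_square w) r (t, s).
by move/(congr1 (fun v : smap (sprod X (simplex k)) A => v l (x, u))).
Qed.

Program Definition comma_to_exp_square l (p : sprod X (simplex n) l) :
    smap (sprod (simplex 1) (simplex l)) A :=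
  @SMap (sprod (simplex 1) (simplex l)) A (fun q r =>
    sq r.1 (dcomp p.2 r.2) q (act r.2 p.1, did q)) _.
Next Obligation.
move=> l [x s] k m t [u r] /=; rewrite -snat /= -actM.
rewrite (_ : dcomp s (dcomp r t) = dcomp (dcomp s r) t); last exact: dmap_eq.
by rewrite sq_act; congr sfun; congr pair; exact: dmap_eq.
Qed.

Lemma comma_to_exp_src l (p : sprod X (simplex n) l) :
  comma_to_exp_square p l (dconst l ord0, did l) = f l (b l p).
Proof.
case: p => x s /=; rewrite act1 /sq comma_square_src.
by congr (f l (b l _)); congr pair; exact: dmap_eq.
Qed.

Lemma comma_to_exp_tgt l (p : sprod X (simplex n) l) :
  comma_to_exp_square p l (dconst l ord_max, did l) = g l (c l p).
Proof.
case: p => x s /=; rewrite act1 /sq comma_square_tgt.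
by congr (g l (c l _)); congr pair; exact: dmap_eq.
Qed.

Program Definition comma_to_exp_cell : sexp X W n :=
  @SMap (sprod X (simplex n)) W
    (fun l p => comma_mk (comma_to_exp_src p) (comma_to_exp_tgt p)) _.
Next Obligation.
move=> k l t [x s]; apply: comma_eq; [exact: (snat b)|exact: (snat c)|].
by move=> m [r u]; rewrite comma_square_act /= -actM.
Qed.

End OfSquare.

Program Definition comma_to_exp : smap WX (sexp X W) := @SMap _ _ comma_to_exp_cell _.
Next Obligation.
by move=> m n t w; apply: smap_eq => l [x s]; exact: comma_eq.
Qed.

Lemma exp_to_commaK n : cancel (@sfun _ _ exp_to_comma n) (@sfun _ _ comma_to_exp n).
Proof.
move=> a; apply: smap_eq => l [x s]; apply: comma_eq => // m [t r] /=.
pose a' : smap (sprod X (simplex n)) W := a.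
transitivity (comma_square (act r (a' l (x, s))) m (t, did m)).
  rewrite -snat; congr (sfun (comma_square (sfun a' (_, _))) (_, _)); exact: dmap_eq.
by rewrite comma_square_act; congr sfun; congr pair; exact: dmap_eq.
Qed.

Lemma comma_to_expK n : cancel (@sfun _ _ comma_to_exp n) (@sfun _ _ exp_to_comma n).
Proof.
move=> w; apply: comma_eq; [exact: smap_eq|exact: smap_eq|].
move=> m [t s]; apply: smap_eq => l [x r] /=.
rewrite act1 (_ : dcomp (dcomp s r) (did l) = dcomp s r); last exact: dmap_eq.
by apply: etrans (sq_act _ _ _ _ _ _) _; congr sfun; congr pair; exact: dmap_eq.
Qed.

(** The link with the comparison functor: its 2-cell, defined through a transport and a class of
    paths, becomes the arrow of a vertex of f^X|g^X, to which the results on commas apply. *)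
Lemma whiskerE (a : qhom X W) :
  whisker (comma_cell f g) a = ho_edge (comma_aedge (exp_to_comma 0 a)).
Proof.
rewrite /whisker /comma_cell /qhom_pre ho_map_edge; apply: hcast_ho_edge.
apply: smap_eq => l [x r] /=.
pose a' : smap (sprod X (simplex 0)) W := a.
transitivity (comma_square (a' l (x, dconst l ord0)) l (r, did l)) => //.
by congr (sfun (comma_square (sfun a' (_, _))) (_, _));
  first [exact: dmap0|exact: dmap_eq].
Qed.

Lemma comma_obj_edge_eq (b b' : qhom X B) (c c' : qhom X C)
    (e : edge (qhom_post X f b) (qhom_post X g c))
    (e' : edge (qhom_post X f b') (qhom_post X g c')) :
  b = b' -> c = c' -> edge_cell e = edge_cell e' ->
  CommaObj (ho_edge e) = CommaObj (ho_edge e').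
Proof. by move=> eb ec; subst b' c' => /edge_eq->. Qed.

(** * The smothering conditions for the comparison functor *)

Hypotheses (hA : quasi_category A) (hB : quasi_category B) (hC : quasi_category C).
Let F := cone_functor (comma_cell f g) X.

Lemma cone_functor_surjective : surjective_on_objects F.
Proof.
case=> b c al; have [e ->] := ho_edge_surj (sexp_quasi_category (X := X) hA) al.
have [w [wb wc we]] := comma_vertex_of_edge e.
exists (comma_to_exp 0 w); rewrite /F /= whiskerE.
apply: (@comma_obj_edge_eq _ b _ c _ e); [..|apply: etrans we].
- by rewrite -wb; exact: smap_eq.
- by rewrite -wc; exact: smap_eq.
exact: (congr1 (fun v => edge_cell (comma_aedge v)) (comma_to_expK w)).
Qed.

(** By [whiskerE], the commutation condition on a morphism of the comma category is the hypothesis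
    of [comma_edge_full] for f^X and g^X. *)
Lemma cone_functor_full : full F.
Proof.
move=> x y v.
have [u uE] := ho_edge_surj (sexp_quasi_category (X := X) hB) (ch_dom v).
have [w wE] := ho_edge_surj (sexp_quasi_category (X := X) hC) (ch_cod v).
have comm : fhom (ho_map (sexp_post X g)) (ho_edge w) \oc whisker (comma_cell f g) x
    = whisker (comma_cell f g) y \oc fhom (ho_map (sexp_post X f)) (ho_edge u).
  by have := ch_comm v; rewrite uE wE.
rewrite !whiskerE !ho_map_edge in comm.
have [E [E0 E1]] := @comma_edge_full _ _ _ (sexp_post X f) (sexp_post X g)
  (sexp_quasi_category (X := X) hA) (exp_to_comma 0 x) (exp_to_comma 0 y) u w comm.
have src : act (@dface 0 ord_max) (comma_to_exp 1 E) = x.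
  by rewrite -snat edge_src exp_to_commaK.
have tgt : act (@dface 0 ord0) (comma_to_exp 1 E) = y.
  by rewrite -snat edge_tgt exp_to_commaK.
exists (ho_edge (Edge src tgt)); apply: comma_hom_eq.
  rewrite uE /= ho_map_homE; congr (cls (pcons _ _)); apply: edge_eq.
  by rewrite -E0; exact: smap_eq.
rewrite wE /= ho_map_homE; congr (cls (pcons _ _)); apply: edge_eq.
by rewrite -E1; exact: smap_eq.
Qed.

Lemma cone_functor_conservative : conservative F.
Proof.
move=> x y u iu.
have hWX := sexp_quasi_category (X := X)
  (comma_quasi_category (f := f) (g := g) hA hB hC).
have [E uE] := ho_edge_surj hWX u; subst u.
have i0 : is_iso (fhom (qhom_post X (comma_p0 f g)) (ho_edge E)).
  case: iu => v [vu uv]; exists (ch_dom v).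
  split; [exact: (congr1 (@ch_dom _ _ _ _ _ _ _) vu)|].
  exact: (congr1 (@ch_dom _ _ _ _ _ _ _) uv).
have i1 : is_iso (fhom (qhom_post X (comma_p1 f g)) (ho_edge E)).
  case: iu => v [vu uv]; exists (ch_cod v).
  split; [exact: (congr1 (@ch_cod _ _ _ _ _ _ _) vu)|].
  exact: (congr1 (@ch_cod _ _ _ _ _ _ _) uv).
rewrite /qhom_post !ho_map_edge in i0 i1.
pose E' := edge_map exp_to_comma E.
have iE' : is_iso (ho_edge E').
  apply: (comma_conservative (f := sexp_post X f) (g := sexp_post X g));
    [exact: sexp_quasi_category|exact: sexp_quasi_category|exact: sexp_quasi_category|..].
    rewrite ho_map_edge; move: i0; congr (is_iso (ho_edge _)); exact: edge_eq.
  rewrite ho_map_edge; move: i1; congr (is_iso (ho_edge _)); exact: edge_eq.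
have := is_iso_fhom (ho_map comma_to_exp) iE'; rewrite ho_map_edge.
(* The round trip fixes objects only up to a propositional equality, hence the transport of the
   isomorphism. *)
have ex (z : qhom X W) : comma_to_exp 0 (exp_to_comma 0 z) = z :> qhom X W.
  exact: exp_to_commaK.
move/(is_iso_hcast (ex x) (ex y)).
rewrite (@hcast_ho_edge _ _ _ _ _ _ _ _ E) //; exact: exp_to_commaK.
Qed.

End CommaExponential.

Theorem proposition3p3p18 (A B C : sset)
    (hA : quasi_category A) (hB : quasi_category B) (hC : quasi_category C)
    (f : smap B A) (g : smap C A) :
  weak_comma_object f g (comma_p1 f g) (comma_p0 f g) (comma_cell f g).
Proof.
split; first exact: comma_quasi_category.
move=> X _; split.
- exact: cone_functor_surjective.
- exact: cone_functor_full.
- exact: cone_functor_conservative.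
Qed.
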